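(* There exists a $16$-approximation algorithm for the Long Short Partial Cover (LSPC) problem.
   Context: LSPC problem. The input is a range of timeslots $[1,T]$ with an integral demand $d_t\ge 0$ at each timeslot $t$, a set of resources, and an integer $k$ (partiality parameter). Each resource $i$ has an interval $[s(i),e(i)]\subseteq[1,T]$, an integer capacity $w(i)$ and a cost $c(i)$; resources are of two types: short resources, whose interval is a single timeslot, and long resources, whose interval may span one or more timeslots. A resource is active at $t$ if $t$ lies in its interval. A feasible solution consists of a multiset $S$ of resources and a coverage profile, i.e. an integer $k_t\le d_t$ for each timeslot $t$, such that (i) $\sum_t k_t\ge k$; (ii) for every timeslot $t$, the sum of capacities (with multiplicity) of the resources of $S$ active at $t$ is at least $k_t$; (iii) for every timeslot $t$, $S$ contains at most one (copy of one) short resource active at $t$ (arbitrarily many copies of long resources are allowed). The cost is the sum of costs of resources in $S$ with multiplicity; the goal is to minimize cost. An approximation algorithm is understood to run in polynomial time and output a feasible solution of cost at most the stated factor times the optimum. *)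

(* Defs.v *)
From mathcomp Require Import all_boot all_order all_algebra.

Set Implicit Arguments.
Unset Strict Implicit.
Unset Printing Implicit Defensive.

Import Order.TTheory GRing.Theory Num.Theory.

Local Open Scope nat_scope.

(******************************************************************************)
(* Model of computation: a While language over binary trees with natural      *)
(* numbers at the leaves, under a logarithmic cost measure.  Evaluating any   *)
(* (sub)expression costs 1 plus the bit size of its value, so the cost of an  *)
(* operation accounts for the sizes of both its operands and its result.  All *)
(* primitives are computable in time polynomial in these sizes, and a value   *)
(* in a run is never larger than the input plus the cost spent so far; hence  *)
(* polynomial cost here is polynomial time on Turing machines.                *)
(******************************************************************************)

Inductive value := Leaf of nat | Pair of value & value.

(* Numbers are measured by the length of their binary representation. *)
Fixpoint value_size (v : value) : nat :=
  match v with
  | Leaf n => (trunc_log 2 n).+1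
  | Pair v1 v2 => (value_size v1 + value_size v2).+1
  end.

Inductive unop := Fst | Snd.
Inductive binop := Cons | Add | Sub | Mul | Div | Leq.

Inductive expr :=
  | Var of nat
  | Const of nat
  | Un of unop & expr
  | Bin of binop & expr & expr.

Inductive cmd :=
  | Skip
  | Assign of nat & expr
  | Seq of cmd & cmd
  | If of expr & cmd & cmd
  | While of expr & cmd.

(* Ill-typed operands are read as 0. *)
Definition to_num (v : value) : nat := if v is Leaf n then n else 0.

Definition eval_unop (o : unop) (v : value) : value :=
  match o, v with
  | Fst, Pair v1 _ => v1
  | Snd, Pair _ v2 => v2
  | _, Leaf _ => Leaf 0
  end.

Definition eval_binop (o : binop) (v1 v2 : value) : value :=
  let m := to_num v1 in let n := to_num v2 in
  match o with
  | Cons => Pair v1 v2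
  | Add => Leaf (m + n)
  | Sub => Leaf (m - n)
  | Mul => Leaf (m * n)
  | Div => Leaf (m %/ n)
  | Leq => Leaf (m <= n)
  end.

Definition store := nat -> value.

Definition update (s : store) (x : nat) (v : value) : store :=
  fun y => if y == x then v else s y.

Fixpoint eval (s : store) (e : expr) : value :=
  match e with
  | Var x => s x
  | Const n => Leaf n
  | Un o e1 => eval_unop o (eval s e1)
  | Bin o e1 e2 => eval_binop o (eval s e1) (eval s e2)
  end.

Fixpoint eval_cost (s : store) (e : expr) : nat :=
  (value_size (eval s e)).+1 +
  match e with
  | Var _ | Const _ => 0
  | Un _ e1 => eval_cost s e1
  | Bin _ e1 e2 => eval_cost s e1 + eval_cost s e2
  end.

(* Everything but the number 0 counts as true; with lists encoded as below, a
   list is true iff it is nonempty. *)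
Definition truthy (v : value) : bool := if v is Leaf 0 then false else true.

(* [exec c s s' t]: started in store [s], the program [c] halts in store [s']
   and the run costs [t]. *)
Inductive exec : cmd -> store -> store -> nat -> Prop :=
  | ExecSkip s : exec Skip s s 1
  | ExecAssign x e s :
      exec (Assign x e) s (update s x (eval s e)) (eval_cost s e).+1
  | ExecSeq c1 c2 s s1 s2 t1 t2 :
      exec c1 s s1 t1 -> exec c2 s1 s2 t2 ->
      exec (Seq c1 c2) s s2 (t1 + t2).+1
  | ExecIf e c1 c2 s s' t :
      exec (if truthy (eval s e) then c1 else c2) s s' t ->
      exec (If e c1 c2) s s' (eval_cost s e + t).+1
  | ExecWhileFalse e c s :
      ~~ truthy (eval s e) -> exec (While e c) s s (eval_cost s e).+1
  | ExecWhileTrue e c s s1 s2 t1 t2 :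
      truthy (eval s e) -> exec c s s1 t1 -> exec (While e c) s1 s2 t2 ->
      exec (While e c) s s2 (eval_cost s e + t1 + t2).+1.

Lemma exec_det c s s1 s2 t1 t2 :
  exec c s s1 t1 -> exec c s s2 t2 -> s1 = s2 /\ t1 = t2.
Proof.
move=> H; elim: H s2 t2 => {c s s1 t1}; try by move=> *; match goal with
  H : exec _ _ _ _ |- _ => inversion H end.
- move=> c1 c2 s s1 s2 t1 t2 _ IH1 _ IH2 s' t' H.
  inversion H; subst.
  match goal with H1 : exec c1 _ _ _ |- _ => have [? ?] := IH1 _ _ H1 end.
  subst.
  by match goal with H2 : exec c2 _ _ _ |- _ => have [-> ->] := IH2 _ _ H2 end.
- move=> e c1 c2 s s' t _ IH s2 t2 H.
  inversion H; subst.
  by match goal with H1 : exec (if _ then _ else _) _ _ _ |- _ =>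
    have [-> ->] := IH _ _ H1 end.
- move=> e c s /negP He s2 t2 H.
  by inversion H; subst.
- move=> e c s s1 s2 t1 t2 He _ IH1 _ IH2 s' t' H.
  inversion H; subst; first by exfalso; apply/negP: He.
  by match goal with H2 : exec (While e c) _ _ _, H1 : exec c _ _ _ |- _ =>
    have [? ?] := IH1 _ _ H1; subst; have [-> ->] := IH2 _ _ H2 end.
Qed.

(* Variable 0 holds the input at the start and the output at the end. *)
Definition init (v : value) : store := fun x => if x == 0 then v else Leaf 0.

Definition enc_list (l : seq value) : value := foldr Pair (Leaf 0) l.

Definition enc_rat (q : rat) : value := Pair (Leaf `|numq q|) (Leaf `|denq q|).

Record min_problem := MinProblem {
  instance : Type;
  solution : instance -> Type;
  feasible : forall I : instance, solution I -> Prop;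
  objective : forall I : instance, solution I -> rat;
  enc_instance : instance -> value;
  enc_solution : forall I : instance, solution I -> value
}.

Definition halts_with (p : cmd) (input output : value) (t : nat) : Prop :=
  exists2 s : store, exec p (init input) s t & s 0 = output.

(* The running time is polynomial on all instances; nothing is required of the
   output on instances without feasible solutions. *)
Definition approximation_algorithm (P : min_problem) (alpha : rat) (p : cmd)
    : Prop :=
  exists b : {poly nat}, forall I : instance P,
  exists (out : value) (t : nat),
    [/\ halts_with p (enc_instance I) out t,
        t <= (b.[value_size (enc_instance I)])%R
      & (exists S : solution I, feasible S) ->
        exists S : solution I,
          [/\ out = enc_solution S,
              feasible S
            & forall S' : solution I, feasible S' ->
                (objective S <= alpha * objective S')%R]].

(* The timeslots 1, ..., T are represented by the elements 0, ..., T - 1 of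
   'I_T. *)
Record resource (T : nat) := Resource {
  is_short : bool;
  start : 'I_T;
  finish : 'I_T;
  capacity : nat;
  price : rat;
  start_le_finish : start <= finish;
  short_single : is_short -> start = finish;
  price_ge0 : (0 <= price)%R
}.

Definition active (T : nat) (r : resource T) (t : 'I_T) : bool :=
  start r <= t <= finish r.

Record lspc_instance := LSPCInstance {
  horizon : nat;
  demand : 'I_horizon -> nat;
  num_resources : nat;
  res : 'I_num_resources -> resource horizon;
  target : nat
}.

Arguments demand : clear implicits.
Arguments res : clear implicits.

Record lspc_solution (I : lspc_instance) := LSPCSolution {
  copies : 'I_(num_resources I) -> nat;
  coverage : 'I_(horizon I) -> nat
}.

Definition lspc_feasible (I : lspc_instance) (S : lspc_solution I) : Prop :=
  [/\ forall t, coverage S t <= demand I t,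
      target I <= \sum_t coverage S t,
      forall t, coverage S t <=
        \sum_(i | active (res I i) t) copies S i * capacity (res I i)
    & forall t, \sum_(i | is_short (res I i) && active (res I i) t)
        copies S i <= 1].

Definition lspc_cost (I : lspc_instance) (S : lspc_solution I) : rat :=
  (\sum_i price (res I i) *+ copies S i)%R.

Definition enc_resource (T : nat) (r : resource T) : value :=
  enc_list [:: Leaf (is_short r); Leaf (start r); Leaf (finish r);
               Leaf (capacity r); enc_rat (price r)].

Definition enc_lspc_instance (I : lspc_instance) : value :=
  enc_list [:: enc_list [seq Leaf (demand I t) | t : 'I_(horizon I)];
               enc_list [seq enc_resource (res I i) | i : 'I_(num_resources I)];
               Leaf (target I)].

(* Multiplicities are output in binary: the number of copies may be exponential
   in the size of the instance. *)
Definition enc_lspc_solution (I : lspc_instance) (S : lspc_solution I) : value :=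
  enc_list [:: enc_list [seq Leaf (copies S i) | i : 'I_(num_resources I)];
               enc_list [seq Leaf (coverage S t) | t : 'I_(horizon I)]].

Definition LSPC : min_problem :=
  {| instance := lspc_instance;
     solution := lspc_solution;
     feasible := lspc_feasible;
     objective := lspc_cost;
     enc_instance := enc_lspc_instance;
     enc_solution := enc_lspc_solution |}.

(* Main.v *)
Require Import Defs.
From mathcomp Require Import all_boot all_order all_algebra zify ring lra.

(* Structure of cheap solutions.  Cut the copies of a long resource of capacity w
   and price c into w unit pieces of price c / w each.  A minimal subfamily of
   intervals with the same union has depth at most 2, so that removing such
   subfamilies one after the other gives layers of which the r-th (from r = 0) still
   covers every slot of load more than 2 r.  All slots of load in (2^l, 2^(l+1)] are
   hence covered by each layer of index between 2^l / 4 and 2^l / 2; the cheapest of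
   these, bought at height 2^(l+1), costs at most 8 times their total price.
   Rounding up to whole copies loses a factor 3 / 2, except for resources of at least
   half that height, for which two copies, bought once for all levels, suffice.  So
   the loads of the long resources are dominated by the maximum of a family of boxes
   (copies of a single resource, from polynomially many candidates) of at most
   8 * 3 / 2 + 2 = 14 times the price.

   Optimising over boxes.  Under the maximum, crossing boxes can be shortened until
   they are nested or disjoint, so an interval dynamic program over pairs (interval,
   base height) finds the best family together with the short resources.  The
   coverage is maximised for each budget, with prices scaled and rounded up as in the
   knapsack scheme, which loses a factor 8 / 7; and 14 * 8 / 7 = 16.

   Running time.  The functions computed by programs in polynomial time are closed
   under composition and under loops whose states stay polynomially small, which
   reduces the running time to size bounds for the tables of the dynamic program. *)

Set Implicit Arguments.
Unset Strict Implicit.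
Unset Printing Implicit Defensive.

Import Order.TTheory GRing.Theory Num.Theory.

(** * Polynomial-time functions on encoded data *)

Class encodable (A : Type) := Encodable { enc : A -> value }.

#[global] Instance nat_enc : encodable nat := {| enc := Leaf |}.
#[global] Instance bool_enc : encodable bool := {| enc := fun b : bool => Leaf b |}.
#[global] Instance unit_enc : encodable unit := {| enc _ := Leaf 0 |}.
#[global] Instance prod_enc A B `{encodable A} `{encodable B} :
  encodable (A * B) := {| enc p := Pair (enc p.1) (enc p.2) |}.
#[global] Instance seq_enc A `{encodable A} : encodable (seq A) :=
  {| enc l := enc_list (map enc l) |}.

Definition esize A `{encodable A} (a : A) : nat := value_size (enc a).

Lemma esize_nat (n : nat) : esize n = (trunc_log 2 n).+1.
Proof. by []. Qed.

Lemma esize_pair A B `{encodable A} `{encodable B} (a : A) (b : B) :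
  esize (a, b) = (esize a + esize b).+1.
Proof. by []. Qed.

Lemma esize_cons A `{encodable A} (a : A) (l : seq A) :
  esize (a :: l) = (esize a + esize l).+1.
Proof. by []. Qed.

Lemma esize_nil A `{encodable A} : esize ([::] : seq A) = 1.
Proof. by []. Qed.

Lemma size_le_esize A `{encodable A} (l : seq A) : size l < esize l.
Proof. by elim: l => //= a l IH; rewrite esize_cons; lia. Qed.

Lemma esize_mem (A : eqType) `{encodable A} (a : A) (l : seq A) :
  a \in l -> esize a < esize l.
Proof.
elim: l => //= b l IH; rewrite esize_cons inE => /orP[/eqP ->|/IH]; lia.
Qed.

Lemma esize_seq_le A `{encodable A} (l : seq A) m :
  (forall a, List.In a l -> esize a <= m) -> esize l <= size l * m.+1 + 1.
Proof.
elim: l => //= a l IH Hl; rewrite esize_cons.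
have := Hl a (or_introl erefl); have := IH (fun b Hb => Hl b (or_intror Hb)).
by rewrite mulSn; lia.
Qed.

Lemma ltn_exp2_esize (n : nat) : n < 2 ^ esize n.
Proof. exact: trunc_log_ltn. Qed.

Lemma esize_nat_le (n k : nat) : n < 2 ^ k.+1 -> esize n <= k.+1.
Proof.
move=> Hn; rewrite esize_nat ltnS.
case: n Hn => [|n] Hn; first by rewrite trunc_log0.
by rewrite -ltnS -(ltn_exp2l (m := 2)) //; apply: leq_ltn_trans Hn; apply: trunc_logP.
Qed.

Lemma esize_nat_mono (m n : nat) : m <= n -> esize m <= esize n.
Proof. by move=> Hmn; rewrite !esize_nat ltnS; apply: leq_trunc_log. Qed.

Lemma leq_exp2rW m n k : m <= n -> m ^ k <= n ^ k.
Proof. by case: k => // k; rewrite leq_exp2r. Qed.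

(** * Functions bounded by a polynomial in the size of their argument *)

Section PolynomialBounds.
Context {A : Type} `{encodable A}.

(** As the base exceeds 1, a single exponent absorbs coefficients, constants and sums. *)
Definition pbound (m : A -> nat) := exists k, forall a, m a <= (esize a).+2 ^ k.

Lemma pbound_le (m1 m2 : A -> nat) :
  pbound m2 -> (forall a, m1 a <= m2 a) -> pbound m1.
Proof. by move=> [k Hk] Hm; exists k => a; apply: leq_trans (Hm a) (Hk a). Qed.

Lemma pbound_const c : pbound (fun _ => c).
Proof.
exists c => a; by apply: leq_trans (ltnW (ltn_expl c (ltnSn 1))) _; apply: leq_exp2rW.
Qed.

Lemma pbound_esize : pbound (fun a => esize a).
Proof. by exists 1 => a; rewrite expn1; lia. Qed.

Lemma pbound_add m1 m2 : pbound m1 -> pbound m2 -> pbound (fun a => m1 a + m2 a).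
Proof.
move=> [k1 H1] [k2 H2]; exists (k1 + k2).+1 => a.
set n := (esize a).+2; have n_gt1 : 1 < n by [].
have L1 : n ^ k1 <= n ^ (k1 + k2) by rewrite leq_exp2l // leq_addr.
have L2 : n ^ k2 <= n ^ (k1 + k2) by rewrite leq_exp2l // leq_addl.
have := H1 a; have := H2 a; rewrite -/n expnS => X1 X2.
apply: (@leq_trans (2 * n ^ (k1 + k2))); first by lia.
by rewrite leq_mul2r n_gt1 orbT.
Qed.

Lemma pbound_mul m1 m2 : pbound m1 -> pbound m2 -> pbound (fun a => m1 a * m2 a).
Proof.
by move=> [k1 H1] [k2 H2]; exists (k1 + k2) => a; rewrite expnD leq_mul.
Qed.

Lemma pbound_S m : pbound m -> pbound (fun a => (m a).+1).
Proof.
move=> Hm; apply: (pbound_le (pbound_add Hm (pbound_const 1))) => a.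
by rewrite addn1.
Qed.

Lemma pbound_exp m k : pbound m -> pbound (fun a => m a ^ k).
Proof.
move=> Hm; elim: k => [|k IH]; first exact: pbound_const.
apply: (pbound_le (pbound_mul Hm IH)) => a; by rewrite expnS.
Qed.

End PolynomialBounds.

Ltac pb := do ?[done | exact: pbound_esize | exact: pbound_const
  | apply: pbound_exp | apply: pbound_mul | apply: pbound_add | apply: pbound_S].

Lemma pbound_comp A B `{encodable A} `{encodable B} (f : A -> B) m :
  pbound (fun a => esize (f a)) -> pbound m -> pbound (fun a => m (f a)).
Proof.
move=> Hf [k Hk].
by apply: (pbound_le (pbound_exp k (pbound_S (pbound_S Hf)))) => a.
Qed.

(** * Total correctness of programs with time bounds *)

Definition runs (p : cmd) (s : store) (T : nat) (Q : store -> Prop) :=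
  exists s' t, [/\ exec p s s' t, t <= T & Q s'].

Lemma runs_assign x e s T (Q : store -> Prop) :
  eval_cost s e < T -> Q (update s x (eval s e)) -> runs (Assign x e) s T Q.
Proof. by move=> HT HQ; do 2!eexists; split; [exact: ExecAssign| |]. Qed.

(** The run of [p2] sits in the postcondition of [p1], so that programs are verified by forward
    symbolic execution. *)
Lemma runs_seq p1 p2 s T T1 T2 Q :
  runs p1 s T1 (fun s' => runs p2 s' T2 Q) -> T1 + T2 < T -> runs (Seq p1 p2) s T Q.
Proof.
move=> [s1 [t1 [E1 L1 [s2 [t2 [E2 L2 HQ]]]]]] HT.
exists s2, (t1 + t2).+1; split => //; [exact: ExecSeq E1 E2 | lia].
Qed.

Lemma runs_conseq p s T T' (Q Q' : store -> Prop) :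
  runs p s T Q -> T <= T' -> (forall s', Q s' -> Q' s') -> runs p s T' Q'.
Proof.
move=> [s' [t [E L HQ]]] HT HQQ; exists s', t; split; auto; lia.
Qed.

Lemma runs_if e p1 p2 s T T' Q :
  runs (if truthy (eval s e) then p1 else p2) s T' Q ->
  eval_cost s e + T' < T -> runs (If e p1 p2) s T Q.
Proof.
move=> [s' [t [E L HQ]]] HT; exists s', (eval_cost s e + t).+1.
by split => //; [exact: ExecIf | lia].
Qed.

Lemma runs_while_true e p s T T1 T2 Q :
  truthy (eval s e) -> runs p s T1 (fun s' => runs (While e p) s' T2 Q) ->
  eval_cost s e + T1 + T2 < T -> runs (While e p) s T Q.
Proof.
move=> He [s1 [t1 [E1 L1 [s2 [t2 [E2 L2 HQ]]]]]] HT.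
exists s2, (eval_cost s e + t1 + t2).+1.
by split => //; [exact: ExecWhileTrue E1 E2 | lia].
Qed.

Lemma runs_while_false e p s T (Q : store -> Prop) :
  ~~ truthy (eval s e) -> eval_cost s e < T -> Q s -> runs (While e p) s T Q.
Proof. by move=> He HT HQ; do 2!eexists; split; [exact: ExecWhileFalse| |]. Qed.

Section Polytime.
Context {A B : Type} `{encodable A} `{encodable B}.

(* The program for input variable [x] and output variable [n] may use every
   variable from [n] on as scratch space; all variables below [n] survive, so
   that nested computations need no stack. *)
Definition computes (f : A -> B) (T : A -> nat) (x n : nat) (p : cmd) :=
  forall s a, s x = enc a ->
    runs p s (T a) (fun s' => s' n = enc (f a) /\ forall y, y < n -> s' y = s y).

(** The time of a composition is polynomial in the size of the intermediate value, hence the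
    separate bound on output sizes. [T] is fixed before the variables and so does not depend on
    their choice. *)
Definition polytime (f : A -> B) :=
  pbound (fun a => esize (f a)) /\
  exists2 T, pbound T & forall x n, x < n -> exists p, computes f T x n p.

Lemma polytime_ext (f g : A -> B) : f =1 g -> polytime f -> polytime g.
Proof.
move=> fg [Hs [T HT Hc]]; split.
  by apply: (pbound_le Hs) => a; rewrite fg.
exists T => // x n /Hc[p Hp]; exists p => s a /Hp R.
by apply: (runs_conseq R) => // s' []; rewrite fg.
Qed.

End Polytime.

Lemma updateE s x v y : update s x v y = if y == x then v else s y.
Proof. by []. Qed.

Lemma polytime_id A `{encodable A} : polytime (fun a : A => a).
Proof.
split; first exact: pbound_esize.
exists (fun a => (esize a).+3); first by do 3!apply: pbound_S; apply: pbound_esize.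
move=> x n xn; exists (Assign n (Var x)) => s a sx.
apply: runs_assign => /=; first by rewrite sx addn0 ltnS.
split; first by rewrite updateE eqxx.
by move=> y yn; rewrite updateE ltn_eqF.
Qed.

Lemma polytime_comp A B C `{encodable A} `{encodable B} `{encodable C}
    (g : B -> C) (f : A -> B) :
  polytime g -> polytime f -> polytime (fun a => g (f a)).
Proof.
move=> [sg [Tg bg Hg]] [sf [Tf bf Hf]]; split; first exact: (pbound_comp sf sg).
exists (fun a => (Tf a + (Tg (f a) + (esize (g (f a))).+3).+1).+1).
  have sgf := pbound_comp sf sg; have tgf := pbound_comp sf bg.
  pb.
move=> x n xn; have [p Hp] := Hf x n xn; have [q Hq] := Hg n n.+1 (ltnSn n).
exists (Seq p (Seq q (Assign n (Var n.+1)))) => s a sx.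
apply: runs_seq (ltnSn _); apply: (runs_conseq (Hp s a sx)) => // s1 [s1n s1y].
apply: runs_seq (ltnSn _); apply: (runs_conseq (Hq s1 _ s1n)) => // s2 [s2n s2y].
apply: runs_assign => /=; first by rewrite s2n addn0 ltnS.
split; first by rewrite updateE eqxx.
by move=> y yn; rewrite updateE ltn_eqF // s2y ?s1y // ltnW.
Qed.

Lemma trunc_log_add m n : trunc_log 2 (m + n) <= (trunc_log 2 m + trunc_log 2 n).+1.
Proof.
have := ltn_exp2_esize m; have := ltn_exp2_esize n; rewrite !esize_nat => Hn Hm.
have : m + n < 2 ^ (trunc_log 2 m + trunc_log 2 n).+2.
  have -> : (trunc_log 2 m + trunc_log 2 n).+2 = (trunc_log 2 m).+1 + (trunc_log 2 n).+1.
    by lia.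
  rewrite expnD.
  move: Hn Hm; set x := 2 ^ _; set y := 2 ^ _ => Hn Hm.
  have : 1 < x by rewrite /x expnS; have := expn_gt0 2 (trunc_log 2 n); lia.
  have : 1 < y by rewrite /y expnS; have := expn_gt0 2 (trunc_log 2 m); lia.
  by nia.
by move/esize_nat_le; rewrite esize_nat.
Qed.

(** Even a product has at most the total bit length of its factors, so sizes can explode only
    through loops. *)
Lemma value_size_binop o v1 v2 :
  value_size (eval_binop o v1 v2) <= (value_size v1 + value_size v2).+1.
Proof.
have L v : (trunc_log 2 (to_num v)).+1 <= value_size v by case: v.
have := L v1; have := L v2.
set m := to_num v1; set n := to_num v2 => Ln Lm.
case: o => //=; rewrite -/m -/n ltnS.
- by have := trunc_log_add m n; lia.
- have : trunc_log 2 (m - n) <= trunc_log 2 m by apply: leq_trunc_log; lia.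
  by lia.
- have := ltn_exp2_esize m; have := ltn_exp2_esize n; rewrite !esize_nat => Hn Hm.
  have : m * n < 2 ^ ((trunc_log 2 m).+1 + (trunc_log 2 n).+1).
    by rewrite expnD; apply: ltn_mul.
  by rewrite addSn => /esize_nat_le; rewrite esize_nat; lia.
- have : trunc_log 2 (m %/ n) <= trunc_log 2 m by apply: leq_trunc_log; apply: leq_div.
  by lia.
- by case: (m <= n) => /=; rewrite ?trunc_log0 ?trunc_log1; lia.
Qed.

Section BinaryOperations.
Context {X A B C : Type}.
Context `{encodable X} `{encodable A} `{encodable B} `{encodable C}.

(** Types matter only through their encodings; thus the primitive [Cons] serves both pairs and list
    cells. *)
Lemma polytime_binop o (h : A -> B -> C) (f : X -> A) (g : X -> B) :
  (forall a b, eval_binop o (enc a) (enc b) = enc (h a b)) ->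
  polytime f -> polytime g -> polytime (fun x => h (f x) (g x)).
Proof.
move=> hE [sf [Tf bf Hf]] [sg [Tg bg Hg]].
have sh x : esize (h (f x) (g x)) <= (esize (f x) + esize (g x)).+1.
  by rewrite /esize -hE value_size_binop.
split; first by apply: (pbound_le (pbound_S (pbound_add sf sg))).
pose (T := fun x => (Tf x + (Tg x + ((esize (f x) + esize (g x)).+3 +
  ((esize (f x)).+3 + (esize (g x)).+3)).+1).+1).+1).
exists T; first by rewrite /T; pb.
move=> x n xn; have [p Hp] := Hf x n xn.
have [q Hq] := Hg x n.+1 (ltnW xn).
exists (Seq p (Seq q (Assign n (Bin o (Var n) (Var n.+1))))) => s a sx.
apply: runs_seq (ltnSn _); apply: (runs_conseq (Hp s a sx)) => // s1 [s1n s1y].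
have s1x : s1 x = enc a by rewrite s1y.
apply: runs_seq (ltnSn _); apply: (runs_conseq (Hq s1 _ s1x)) => // s2 [s2n s2y].
have s2n' : s2 n = enc (f a) by rewrite s2y.
apply: runs_assign => /=; rewrite s2n s2n' hE.
  by have := sh a; rewrite /esize !addn0; lia.
split; first by rewrite updateE eqxx.
by move=> y yn; rewrite updateE ltn_eqF // s2y ?s1y // ltnW.
Qed.

End BinaryOperations.

Lemma polytime_unop X A B `{encodable X} `{encodable A} `{encodable B}
    o (h : A -> B) (f : X -> A) :
  (forall a, eval_unop o (enc a) = enc (h a)) ->
  polytime f -> polytime (fun x => h (f x)).
Proof.
move=> hE [sf [Tf bf Hf]].
have sh x : esize (h (f x)) <= esize (f x).
  by rewrite /esize -hE; case: o {hE}; case: (enc _) => //= *; lia.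
split; first by apply: (pbound_le sf).
pose (T := fun x => (Tf x + ((esize (f x)).+3 + (esize (f x)).+3)).+1).
exists T; first by rewrite /T; pb.
move=> x n xn; have [p Hp] := Hf x n xn.
exists (Seq p (Assign n (Un o (Var n)))) => s a sx.
apply: runs_seq (ltnSn _); apply: (runs_conseq (Hp s a sx)) => // s1 [s1n s1y].
apply: runs_assign => /=; rewrite s1n hE.
  by have := sh a; rewrite /esize !addn0; lia.
split; first by rewrite updateE eqxx.
by move=> y yn; rewrite updateE ltn_eqF // s1y.
Qed.

Section Closure.
Context {X : Type} `{encodable X}.

Lemma polytime_pair A B `{encodable A} `{encodable B} (f : X -> A) (g : X -> B) :
  polytime f -> polytime g -> polytime (fun x => (f x, g x)).
Proof. exact: (polytime_binop (o := Defs.Cons)). Qed.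

Lemma polytime_cons A `{encodable A} (f : X -> A) (g : X -> seq A) :
  polytime f -> polytime g -> polytime (fun x => f x :: g x).
Proof. exact: (polytime_binop (o := Defs.Cons)). Qed.

Lemma polytime_add (f g : X -> nat) :
  polytime f -> polytime g -> polytime (fun x => f x + g x).
Proof. exact: (polytime_binop (o := Defs.Add)). Qed.

Lemma polytime_sub (f g : X -> nat) :
  polytime f -> polytime g -> polytime (fun x => f x - g x).
Proof. exact: (polytime_binop (o := Defs.Sub)). Qed.

Lemma polytime_mul (f g : X -> nat) :
  polytime f -> polytime g -> polytime (fun x => f x * g x).
Proof. exact: (polytime_binop (o := Defs.Mul)). Qed.

Lemma polytime_div (f g : X -> nat) :
  polytime f -> polytime g -> polytime (fun x => f x %/ g x).
Proof. exact: (polytime_binop (o := Defs.Div)). Qed.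

Lemma polytime_leq (f g : X -> nat) :
  polytime f -> polytime g -> polytime (fun x => f x <= g x).
Proof. exact: (polytime_binop (o := Defs.Leq)). Qed.

Lemma polytime_fst A B `{encodable A} `{encodable B} (f : X -> A * B) :
  polytime f -> polytime (fun x => (f x).1).
Proof. exact: (polytime_unop (o := Defs.Fst)). Qed.

Lemma polytime_snd A B `{encodable A} `{encodable B} (f : X -> A * B) :
  polytime f -> polytime (fun x => (f x).2).
Proof. exact: (polytime_unop (o := Defs.Snd)). Qed.

Lemma polytime_nat (c : nat) : polytime (fun _ : X => c).
Proof.
split; first exact: pbound_const.
exists (fun=> (esize c).+3); first exact: pbound_const.
move=> x n xn; exists (Assign n (Const c)) => s a sx.
apply: runs_assign => /=; first by rewrite addn0.
split; first by rewrite updateE eqxx.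
by move=> y yn; rewrite updateE ltn_eqF.
Qed.

(** The program of [f] serves for [g] unchanged; in this way the empty list, [tt] and the booleans
    reduce to numeric constants. *)
Lemma polytime_same_enc A B `{encodable A} `{encodable B} (f : X -> A) (g : X -> B) :
  (forall x, enc (f x) = enc (g x)) -> polytime f -> polytime g.
Proof.
move=> fg [Hs [T HT Hc]]; split.
  by apply: (pbound_le Hs) => a; rewrite /esize fg.
exists T => // x n /Hc[p Hp]; exists p => s a /Hp R.
by apply: (runs_conseq R) => // s' []; rewrite fg.
Qed.

Lemma polytime_nil A `{encodable A} : polytime (fun _ : X => [::] : seq A).
Proof. exact: (polytime_same_enc _ (polytime_nat 0)). Qed.

Lemma polytime_tt : polytime (fun _ : X => tt).
Proof. exact: (polytime_same_enc _ (polytime_nat 0)). Qed.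

Lemma polytime_bool (b : bool) : polytime (fun _ : X => b).
Proof. exact: (polytime_same_enc _ (polytime_nat b)). Qed.

Lemma polytime_if A `{encodable A} (c : X -> bool) (f g : X -> A) :
  polytime c -> polytime f -> polytime g ->
  polytime (fun x => if c x then f x else g x).
Proof.
move=> [_ [Tc bc Hc]] [sf [Tf bf Hf]] [sg [Tg bg Hg]]; split.
  by apply: (pbound_le (pbound_add sf sg)) => x; case: (c x); lia.
pose (T := fun x => (Tc x + (4 + (Tf x + Tg x)).+1).+1).
exists T.
  by rewrite /T; pb.
move=> x n xn; have [pc Hpc] := Hc x n xn.
have [p Hp] := Hf x n xn; have [q Hq] := Hg x n xn.
exists (Seq pc (If (Var n) p q)) => s a sx.
apply: runs_seq (ltnSn _); apply: (runs_conseq (Hpc s a sx)) => // s1 [s1n s1y].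
have s1x : s1 x = enc a by rewrite s1y.
apply: (@runs_if _ _ _ _ _ (Tf a + Tg a)); last first.
  rewrite /= s1n addn0 /=.
  by case: (c a) => /=; rewrite ?trunc_log0 ?trunc_log1; lia.
rewrite /= s1n; case: (c a) => /=.
  apply: (runs_conseq (Hp s1 a s1x)); first by lia.
  by move=> s' [-> Hs']; split=> // y yn; rewrite Hs' ?s1y.
apply: (runs_conseq (Hq s1 a s1x)); first by lia.
by move=> s' [-> Hs']; split=> // y yn; rewrite Hs' ?s1y.
Qed.

Lemma polytime_seq_case A B `{encodable A} `{encodable B} (l : X -> seq A)
    (f : X -> B) (g : X * (A * seq A) -> B) :
  polytime l -> polytime f -> polytime g ->
  polytime (fun x => if l x is a :: l' then g (x, (a, l')) else f x).
Proof.
move=> [sl [Tl bl Hl]] [sf [Tf bf Hf]] [sg [Tg bg Hg]].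
have [kg Hkg] := sg; have [kt Hkt] := bg.
pose (m := fun x => (esize x + esize (l x)).+3).
have mE x a l' : l x = a :: l' -> (esize (x, (a, l'))).+2 = m x.
  by move=> E; rewrite /m E !esize_pair esize_cons.
have bm : pbound m.
  by rewrite /m; pb.
split.
  apply: (pbound_le (pbound_add sf (pbound_exp kg bm))) => x.
  case E: (l x) => [|a l']; first by lia.
  by rewrite -(mE _ _ _ E); have := Hkg (x, (a, l')); lia.
pose (B2 := fun x => (Tf x + ((m x + m x + m x) + (m x ^ kt + (m x ^ kg).+3).+1).+1).+1).
pose (T := fun x => (Tl x + ((esize (l x)).+1 + B2 x).+1).+1).
have bkg := pbound_exp kg bm; have bkt := pbound_exp kt bm.
exists T.
  by rewrite /T /B2; pb.
move=> x n xn; have [pl Hpl] := Hl x n xn.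
have [p Hp] := Hf x n xn; have [q Hq] := Hg n n.+1 (ltnSn n).
(* A nonempty list is encoded as the pair of its head and tail, so a single [Cons] with the input
   forms the argument of [g]. *)
pose body := Seq (Assign n (Bin Defs.Cons (Var x) (Var n))) (Seq q (Assign n (Var n.+1))).
exists (Seq pl (If (Var n) body p)) => s a sx.
apply: runs_seq (ltnSn _); apply: (runs_conseq (Hpl s a sx)) => // s1 [s1n s1y].
have s1x : s1 x = enc a by rewrite s1y.
apply: (@runs_if _ _ _ _ _ (B2 a)); last by rewrite /= s1n addn0.
rewrite /= s1n; case E: (l a) => [|b l'] /=.
  apply: (runs_conseq (Hp s1 a s1x)); first by rewrite /B2; lia.
  by move=> s' [-> Hs']; split=> // y yn; rewrite Hs' ?s1y.
have mEa := mE _ _ _ E.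
rewrite /body; apply: (runs_seq (T1 := m a + m a + m a)
  (T2 := (m a ^ kt + (m a ^ kg).+3).+1)); last by rewrite /B2; lia.
apply: runs_assign => /=.
  rewrite s1n s1x E -/(esize _) !addn0 /m E esize_cons.
  have -> : value_size (enc (b :: l')) = (esize b + esize l').+1 by [].
  by rewrite -/(esize a); lia.
set s2 := update _ _ _.
have s2n : s2 n = enc (a, (b, l')) by rewrite /s2 updateE eqxx s1n s1x E.
apply: runs_seq (ltnSn _); apply: (runs_conseq (Hq s2 _ s2n)).
  by rewrite -mEa; apply: Hkt.
move=> s3 [s3n s3y]; apply: runs_assign => /=.
  by rewrite s3n -/(esize _) -mEa addn0; have := Hkg (a, (b, l')); lia.
split; first by rewrite updateE eqxx.
move=> y yn; rewrite updateE ltn_eqF // s3y; last exact: ltnW.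
by rewrite /s2 updateE ltn_eqF // s1y.
Qed.

End Closure.

(** * While loops with small states *)

Section Loop.
Context {X S : Type} `{encodable X} `{encodable S}.

(** No program computes [num]: the loop stops when [cond] fails. The bound [m] on the intermediate
    states is essential, since iterating a polynomial-time step such as squaring makes sizes
    explode. *)
Lemma polytime_while (cond : S -> bool) (step : S -> S) (z : X -> S)
    (num m : X -> nat) :
  polytime cond -> polytime step -> polytime z -> pbound num -> pbound m ->
  (forall x n, n <= num x -> esize (iter n step (z x)) <= m x) ->
  (forall x n, n <= num x -> cond (iter n step (z x)) = (n < num x)) ->
  polytime (fun x => iter (num x) step (z x)).
Proof.
move=> [_ [Tc bc Hc]] [sst [Ts bs Hs]] [_ [Tz bz Hz]] bnum bm Hm Hcond.
split; first by apply: (pbound_le bm) => x; apply: Hm.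
have [kc Hkc] := bc; have [ks Hks] := bs.
pose (body := fun x => ((m x).+2 ^ ks + ((m x).+3 + (m x).+2 ^ kc).+1).+1).
pose (C := fun x => (num x).+1 * (body x + 5)).
pose (T := fun x => (Tz x + ((m x).+2 ^ kc + C x).+1).+1).
have bm2 : pbound (fun x => (m x).+2) by do 2!apply: pbound_S.
have bkc := pbound_exp kc bm2; have bks := pbound_exp ks bm2.
have bbody : pbound body.
  by rewrite /body; pb.
exists T.
  rewrite /T /C; pb.
move=> x n xn; have [pz Hpz] := Hz x n xn.
have [pc Hpc] := Hc n n.+1 (ltnSn n).
have [ps Hps] := Hs n n.+1 (ltnSn n).
(* Variable [n] holds the state and [n.+1] the value of [cond], recomputed at the end of each
   round. *)
pose loop := Seq ps (Seq (Assign n (Var n.+1)) pc).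
exists (Seq pz (Seq pc (While (Var n.+1) loop))) => s a sx.
apply: runs_seq (ltnSn _); apply: (runs_conseq (Hpz s a sx)) => // s1 [s1n s1y].
apply: runs_seq (ltnSn _); apply: (runs_conseq (Hpc s1 _ s1n)).
  apply: leq_trans (Hkc _) _; apply: leq_exp2rW => //.
  by rewrite !ltnS; apply: (Hm a 0).
move=> s2 [s2n s2y].
have s2z : s2 n = enc (iter 0 step (z a)) by rewrite s2y.
have {}s2y y : y < n -> s2 y = s y by move=> yn; rewrite s2y ?s1y // ltnW.
change (s2 n.+1 = enc (cond (iter 0 step (z a)))) in s2n.
(* Induction on the number [k] of rounds left after [j] rounds. *)
have claim : forall k j s2, num a - j = k -> j <= num a ->
    s2 n.+1 = enc (cond (iter j step (z a))) -> s2 n = enc (iter j step (z a)) ->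
    (forall y, y < n -> s2 y = s y) ->
    runs (While (Var n.+1) loop) s2 (k.+1 * (body a + 5))
      (fun s' => s' n = enc (iter (num a) step (z a)) /\
                 forall y, y < n -> s' y = s y).
  move=> {s1 s1n s1y s2 s2n s2z s2y}.
  elim=> [|k IH] j s2 Ek jN s2n s2z s2y.
    have jE : j = num a by lia.
    apply: runs_while_false => /=; last by split=> //; rewrite s2z jE.
      by rewrite s2n Hcond // jE ltnn.
    by rewrite s2n Hcond // jE ltnn /= trunc_log0; lia.
  have jN' : j < num a by lia.
  have st : esize (iter j.+1 step (z a)) <= m a by apply: Hm.
  apply: (runs_while_true (T1 := body a) (T2 := k.+1 * (body a + 5))).
  - by rewrite /= s2n Hcond // jN'.
  - apply: runs_seq (ltnSn _).
    have s2E : (fun=> Ts (iter j step (z a))) a <= (m a).+2 ^ ks.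
      by apply: leq_trans (Hks _) _; apply: leq_exp2rW; rewrite !ltnS Hm.
    apply: (runs_conseq (Hps s2 _ s2z) s2E) => s3 [s3n s3y].
    apply: runs_seq (ltnSn _); apply: runs_assign => /=.
      by rewrite s3n addn0 !ltnS; apply: leqW st.
    set s4 := update _ _ _.
    have s4n : s4 n = enc (iter j.+1 step (z a)) by rewrite /s4 updateE eqxx s3n.
    have s4E : Tc (iter j.+1 step (z a)) <= (m a).+2 ^ kc.
      by apply: leq_trans (Hkc _) _; apply: leq_exp2rW; rewrite !ltnS.
    apply: (runs_conseq (Hpc s4 _ s4n) s4E) => s5 [s5n s5y].
    apply: (IH j.+1) => //; first by lia.
      by rewrite s5y.
    move=> y yn; rewrite s5y; last exact: ltnW.
    by rewrite /s4 updateE ltn_eqF // s3y ?s2y // ltnW.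
  - rewrite /= s2n Hcond // jN' /= trunc_log1.
    by rewrite [k.+2 * _]mulSn; lia.
exact: (claim (num a) 0 s2 (subn0 _) (leq0n _) s2n s2z s2y).
Qed.

End Loop.

(** * Loops and lists *)

(** A hook, redefined once the closure properties of list functions are available. *)
Ltac pt_derived := fail.

Ltac pt_step := cbv beta; match goal with
  | |- polytime (fun x => x) => exact: polytime_id
  | H : polytime _ |- _ => exact: H
  | |- polytime (fun x => (@?f x, @?g x)) => refine (polytime_pair (f := f) (g := g) _ _)
  | |- polytime (fun x => fst (@?f x)) => refine (polytime_fst (f := f) _)
  | |- polytime (fun x => snd (@?f x)) => refine (polytime_snd (f := f) _)
  | |- polytime (@fst _ _) => refine (polytime_fst (f := fun x => x) _)
  | |- polytime (@snd _ _) => refine (polytime_snd (f := fun x => x) _)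
  | |- polytime (fun x => (@?f x) :: (@?g x)) => refine (polytime_cons (f := f) (g := g) _ _)
  | |- polytime (fun x => [::]) => exact: polytime_nil
  | |- polytime (fun _ => ?c) =>
      match type of c with nat => exact: polytime_nat
      | bool => exact: polytime_bool | unit => exact: polytime_tt end
  | |- polytime (fun x => addn (@?f x) (@?g x)) => refine (polytime_add (f := f) (g := g) _ _)
  | |- polytime (fun x => subn (@?f x) (@?g x)) => refine (polytime_sub (f := f) (g := g) _ _)
  | |- polytime (fun x => muln (@?f x) (@?g x)) => refine (polytime_mul (f := f) (g := g) _ _)
  | |- polytime (fun x => divn (@?f x) (@?g x)) => refine (polytime_div (f := f) (g := g) _ _)
  | |- polytime (fun x => leq (@?f x) (@?g x)) => refine (polytime_leq (f := f) (g := g) _ _)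
  | |- polytime _ => first [pt_derived | apply: polytime_if]
  end.
Ltac pt := do ?pt_step.

Section Foldl.
Context {X A S : Type} `{encodable X} `{encodable A} `{encodable S}.

(** [I x k s] is an invariant of the accumulator after [k] elements; it serves to derive the size
    bound [m]. *)
Lemma polytime_foldl (f : X -> S -> A -> S) (z : X -> S) (l : X -> seq A)
    (I : X -> nat -> S -> Prop) (m : X -> nat) :
  polytime (fun p : (X * S) * A => f p.1.1 p.1.2 p.2) ->
  polytime z -> polytime l -> pbound m ->
  (forall x, I x 0 (z x)) ->
  (forall x k s a, k < size (l x) -> List.In a (l x) -> I x k s -> I x k.+1 (f x s a)) ->
  (forall x k s, k <= size (l x) -> I x k s -> esize s <= m x) ->
  polytime (fun x => foldl (f x) (z x) (l x)).
Proof.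
move=> Hf Hz Hl bm I0 IS Im.
(* The loop state carries the parameter [x] beside the remaining list and the accumulator. *)
pose cond (st : X * (seq A * S)) := if st.2.1 is _ :: _ then true else false.
pose step (st : X * (seq A * S)) :=
  if st.2.1 is a :: l' then (st.1, (l', f st.1 st.2.2 a)) else st.
have pcond : polytime cond.
  by apply: (polytime_seq_case (g := fun=> true)); pt.
have pstep : polytime step.
  have := @polytime_seq_case _ _ _ _ _ _ (fun st : X * (seq A * S) => st.2.1) id
    (fun q => (q.1.1, (q.2.2, f q.1.1 q.1.2.2 q.2.1))).
  apply; first by pt.
  - exact: polytime_id.
  - pt.
    by apply: (polytime_comp (f := fun q => ((q.1.1, q.1.2.2), q.2.1)) Hf); pt.
have pz : polytime (fun x => (x, (l x, z x))).
  by do 2?[apply: polytime_pair] => //; apply: polytime_id.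
have bl : pbound (fun x => esize (l x)) by case: Hl.
have iterE x n : n <= size (l x) -> iter n step (x, (l x, z x)) =
    (x, (drop n (l x), foldl (f x) (z x) (take n (l x)))).
  elim: n => [|n IH] Hn; first by rewrite drop0 take0.
  rewrite iterS (IH (ltnW Hn)) {IH}.
  have : forall s l0, n < size l0 ->
    step (x, (drop n l0, foldl (f x) s (take n l0))) =
    (x, (drop n.+1 l0, foldl (f x) s (take n.+1 l0))).
    by elim: n {Hn} => [|n IH] s [|a l0] //= Hn; rewrite ?drop0 ?take0 //= IH.
  exact.
have Inv x n : n <= size (l x) -> I x n (foldl (f x) (z x) (take n (l x))).
  elim: n => [|n IH] Hn; first by rewrite take0.
  have [a Ha Ea] : exists2 a, List.In a (l x) & take n.+1 (l x) = rcons (take n (l x)) a.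
    elim: n (l x) Hn {IH} => [|n IH] [|a l0] //= Hn.
      by exists a; [left|rewrite take0].
    by have [b Hb ->] := IH l0 Hn; exists b; [right|].
  by rewrite Ea foldl_rcons; apply: IS => //; apply: IH; apply: ltnW.
apply: (@polytime_ext _ _ _ _
  (fun x => (iter (size (l x)) step (x, (l x, z x))).2.2)).
  by move=> x; rewrite iterE // take_size.
apply: polytime_snd; apply: polytime_snd.
apply: (@polytime_while _ _ _ _ cond step _ (fun x => size (l x))
  (fun x => (esize x + (esize (l x) + m x).+1).+1)) => //.
- by apply: (pbound_le bl) => x; apply: ltnW; apply: size_le_esize.
- by pb.
- move=> x n Hn; rewrite iterE // !esize_pair.
  have := Im x n _ Hn (Inv x n Hn).
  have : esize (drop n (l x)) <= esize (l x).
    elim: (l x) n {Hn} => [|a l0 IH] [|n] //=.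
    by rewrite esize_cons; have := IH n; lia.
  lia.
- move=> x n Hn; rewrite iterE // /cond /=.
  have : size (drop n (l x)) = size (l x) - n by rewrite size_drop.
  by case: (drop n (l x)) => [|a l0] /=; lia.
Qed.

End Foldl.

Lemma esize_nat_leS (n : nat) : esize n <= n.+1.
Proof.
case: n => [|n]; first by rewrite esize_nat trunc_log0.
have := trunc_logP (ltnSn 1) (ltn0Sn n); have := ltn_expl (trunc_log 2 n.+1) (ltnSn 1).
by rewrite esize_nat; lia.
Qed.

Lemma esize_catrev A `{encodable A} (s t : seq A) :
  (esize (catrev s t)).+1 = esize s + esize t.
Proof.
elim: s t => [|a s IH] t /=; first by rewrite esize_nil.
by rewrite IH !esize_cons; lia.
Qed.

Lemma esize_In A `{encodable A} (a : A) (l : seq A) : List.In a l -> esize a < esize l.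
Proof. by elim: l => //= b l IH; rewrite esize_cons => -[->|/IH]; lia. Qed.

Lemma esize_addn (m n : nat) : esize (m + n) <= (esize m + esize n).+1.
Proof. exact: (value_size_binop Defs.Add (Leaf m) (Leaf n)). Qed.

Lemma esize_muln (m n : nat) : esize (m * n) <= (esize m + esize n).+1.
Proof. exact: (value_size_binop Defs.Mul (Leaf m) (Leaf n)). Qed.

Lemma foldl_addn (z : nat) l : foldl addn z l = z + sumn l.
Proof. by elim: l z => [|a l IH] z /=; rewrite ?addn0 // IH addnA. Qed.

Lemma polytime_succ X `{encodable X}
    (f : X -> nat) : polytime f -> polytime (fun x => (f x).+1).
Proof.
by move=> Hf; apply: (polytime_ext (f := fun x => f x + 1)) => [x|]; [rewrite addn1|pt].
Qed.

Lemma polytime_eqn X `{encodable X} (f g : X -> nat) :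
  polytime f -> polytime g -> polytime (fun x => f x == g x).
Proof.
move=> Hf Hg.
apply: (polytime_ext (f := fun x => if f x <= g x then g x <= f x else false)).
  by move=> x; rewrite eqn_leq; case: ifP.
by apply: polytime_if; pt.
Qed.

Lemma polytime_andb X `{encodable X} (f g : X -> bool) :
  polytime f -> polytime g -> polytime (fun x => f x && g x).
Proof. by move=> Hf Hg; apply: (polytime_if (g := fun=> false)); pt. Qed.

Lemma polytime_negb X `{encodable X}
    (f : X -> bool) : polytime f -> polytime (fun x => ~~ f x).
Proof.
by move=> Hf; apply: (polytime_if (f := fun=> false) (g := fun=> true)); pt.
Qed.

Lemma polytime_minn X `{encodable X} (f g : X -> nat) :
  polytime f -> polytime g -> polytime (fun x => minn (f x) (g x)).
Proof.
move=> Hf Hg; apply: (polytime_ext (f := fun x => if f x <= g x then f x else g x)).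
  by move=> x; case: leqP.
by apply: polytime_if; pt.
Qed.


(** Growth by at most [d x] per element adds up to at most [d x] times the length of the list. *)
Lemma polytime_foldl_additive X `{encodable X} A S `{encodable A} `{encodable S}
    (f : X -> S -> A -> S) (z : X -> S) (l : X -> seq A)
    (d : X -> nat) :
  polytime (fun p : (X * S) * A => f p.1.1 p.1.2 p.2) ->
  polytime z -> polytime l -> pbound d ->
  (forall x s a, List.In a (l x) -> esize (f x s a) <= esize s + d x) ->
  polytime (fun x => foldl (f x) (z x) (l x)).
Proof.
move=> Hf Hz Hl bd Hfd; have [bz _] := Hz; have [bl _] := Hl.
apply: (polytime_foldl (I := fun x k s => esize s <= esize (z x) + k * d x)
  (m := fun x => esize (z x) + esize (l x) * d x)) => //; first by pb.
- by move=> x; rewrite addn0.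
- by move=> x k s a kl al Is; have := Hfd x s a al; rewrite mulSn; lia.
- move=> x k s kl Is; apply: leq_trans Is _; rewrite leq_add2l leq_mul2r.
  by rewrite (leq_trans kl (ltnW (size_le_esize _))) orbT.
Qed.



(** Pushing onto an accumulator is what a left fold does directly; reversal and concatenation are
    derived from it. *)
Lemma polytime_catrev X `{encodable X} A `{encodable A} (s t : X -> seq A) :
  polytime s -> polytime t -> polytime (fun x => catrev (s x) (t x)).
Proof.
move=> Hs Ht; have [bs _] := Hs.
apply: (polytime_ext (f := fun x => foldl (fun acc a => a :: acc) (t x) (s x))).
  by move=> x; elim: (s x) (t x) => //= a s0 IH t0; rewrite IH.
apply: (polytime_foldl_additive (f := fun _ acc a => a :: acc)
  (d := fun x => (esize (s x)).+1)); try by pt.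
  by pb.
by move=> x acc a Ha; pose proof (esize_In Ha) as al; rewrite esize_cons /=; lia.
Qed.

Lemma polytime_rev X `{encodable X} A `{encodable A}
    (s : X -> seq A) : polytime s -> polytime (fun x => rev (s x)).
Proof. by move=> Hs; apply: (polytime_catrev (t := fun=> [::])); pt. Qed.

Lemma polytime_cat X `{encodable X} A `{encodable A} (s t : X -> seq A) :
  polytime s -> polytime t -> polytime (fun x => s x ++ t x).
Proof.
move=> Hs Ht; apply: (polytime_ext (f := fun x => catrev (rev (s x)) (t x))).
  by move=> x; rewrite catrevE revK.
by apply: polytime_catrev => //; apply: polytime_rev.
Qed.



Lemma polytime_flatmap X `{encodable X} A B `{encodable A} `{encodable B}
    (f : X -> A -> seq B) (l : X -> seq A) :
  polytime (fun p : X * A => f p.1 p.2) -> polytime l ->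
  polytime (fun x => flatten [seq f x a | a <- l x]).
Proof.
move=> Hf Hl; have [bl _] := Hl; have [[k Hk] _] := Hf.
apply: (polytime_ext
  (f := fun x => rev (foldl (fun acc a => catrev (f x a) acc) [::] (l x)))).
  move=> x; rewrite -[RHS]/(rev [::] ++ _); move: [::] => z.
  elim: (l x) z => [|a l0 IH] z /=; first by rewrite cats0.
  by rewrite IH catrevE rev_cat revK catA.
apply: polytime_rev; apply: (polytime_foldl_additive
  (f := fun x acc a => catrev (f x a) acc)
  (d := fun x => (esize x + esize (l x)).+3 ^ k)); try by pt.
- rewrite /=; apply: polytime_catrev; last by pt.
  by apply: (polytime_comp (f := fun q => (q.1.1, q.2)) Hf); pt.
- by pb.
- move=> x acc a Ha; pose proof (esize_In Ha) as al; pose proof (esize_catrev (f x a) acc).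
  have : esize (f x a) <= (esize x + esize (l x)).+3 ^ k.
    by apply: leq_trans (Hk (x, a)) (leq_exp2rW _ _); rewrite esize_pair; lia.
  by rewrite /=; lia.
Qed.

Lemma polytime_map X `{encodable X} A B `{encodable A} `{encodable B}
    (f : X -> A -> B) (l : X -> seq A) :
  polytime (fun p : X * A => f p.1 p.2) -> polytime l ->
  polytime (fun x => [seq f x a | a <- l x]).
Proof.
move=> Hf Hl; apply: (polytime_ext (f := fun x => flatten [seq [:: f x a] | a <- l x])).
  by move=> x; elim: (l x) => //= a l0 ->.
by apply: (polytime_flatmap (f := fun x a => [:: f x a])) => //; pt.
Qed.


Lemma polytime_filter X `{encodable X} A `{encodable A}
    (f : X -> A -> bool) (l : X -> seq A) :
  polytime (fun p : X * A => f p.1 p.2) -> polytime l ->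
  polytime (fun x => [seq a <- l x | f x a]).
Proof.
move=> Hf Hl.
apply: (polytime_ext (f := fun x => flatten [seq if f x a then [:: a] else [::] | a <- l x])).
  by move=> x; elim: (l x) => //= a l0 ->; case: (f x a).
by apply: (polytime_flatmap (f := fun x a => if f x a then [:: a] else [::])) => //; pt.
Qed.

Lemma polytime_sumn X `{encodable X}
    (l : X -> seq nat) : polytime l -> polytime (fun x => sumn (l x)).
Proof.
move=> Hl; have [bl _] := Hl.
apply: (polytime_ext (f := fun x => foldl addn 0 (l x))).
  by move=> x; rewrite foldl_addn.
apply: (polytime_foldl_additive (f := fun _ => addn) (d := fun x => esize (l x))) => //;
  try by pt.
by move=> x n a Ha; pose proof (esize_In Ha); rewrite /=; have := esize_addn n a; lia.
Qed.

Lemma polytime_prodn X `{encodable X} (l : X -> seq nat) :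
  polytime l -> polytime (fun x => foldl muln 1 (l x)).
Proof.
move=> Hl; have [bl _] := Hl.
apply: (polytime_foldl_additive (f := fun _ => muln) (d := fun x => esize (l x))) => //;
  try by pt.
by move=> x n a Ha; pose proof (esize_In Ha); rewrite /=; have := esize_muln n a; lia.
Qed.

(** The accumulator is always [z x] or an element of the list, so it never outgrows them. *)
Lemma polytime_select X `{encodable X} A `{encodable A}
    (R : X -> A -> A -> bool) (z : X -> A)
    (l : X -> seq A) :
  polytime (fun p : (X * A) * A => R p.1.1 p.1.2 p.2) -> polytime z -> polytime l ->
  polytime (fun x => foldl (fun acc a => if R x acc a then a else acc) (z x) (l x)).
Proof.
move=> HR Hz Hl; have [bz _] := Hz; have [bl _] := Hl.
apply: (polytime_foldl (f := fun x acc a => if R x acc a then a else acc)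
  (I := fun x k s => esize s <= esize (z x) + esize (l x))
  (m := fun x => esize (z x) + esize (l x))) => //.
- by pt.
- by pb.
- by move=> x; apply: leq_addr.
- by move=> x k s a _ Ha; pose proof (esize_In Ha) as al; case: ifP => // _ _; lia.
Qed.

Lemma polytime_size X `{encodable X} A `{encodable A} (l : X -> seq A) :
  polytime l -> polytime (fun x => size (l x)).
Proof.
move=> Hl; have [bl _] := Hl.
apply: (polytime_ext (f := fun x => foldl (fun n _ => n.+1) 0 (l x))).
  move=> x; rewrite -[RHS]add0n; move: 0 => z.
  by elim: (l x) z => [|a l0 IH] z /=; rewrite ?addn0 // IH addSnnS.
apply: (polytime_foldl (f := fun _ n _ => n.+1) (I := fun x k n => n = k)
  (m := fun x => esize (l x))) => //.
- by apply: polytime_succ; pt.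
- by pt.
- by move=> x k s a _ _ ->.
- move=> x k s kl ->; apply: (leq_trans (esize_nat_mono kl)).
  by apply: leq_trans (size_le_esize _); apply: esize_nat_leS.
Qed.

(** Ranges are bounded by the length of a list, because [iota 0 n] is exponentially long in the size
    of a binary number [n]. *)
Lemma polytime_indices X `{encodable X} A `{encodable A} (l : X -> seq A) :
  polytime l -> polytime (fun x => iota 0 (size (l x))).
Proof.
move=> Hl; have [bl _] := Hl; have [bs _] := polytime_size Hl.
apply: (polytime_ext (f := fun x =>
    rev (foldl (fun st _ => (st.1.+1, st.1 :: st.2)) (0, [::]) (l x)).2)).
  move=> x.
  suff E z w : rev (foldl (fun st _ => (st.1.+1, st.1 :: st.2)) (z, w) (l x)).2 =
      rev w ++ iota z (size (l x)) by exact: (E 0 [::]).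
  elim: (l x) z w => [|a l0 IH] z w /=; first by rewrite cats0.
  by rewrite IH rev_cons cat_rcons.
apply: polytime_rev; apply: polytime_snd.
apply: (polytime_foldl (f := fun _ st _ => (st.1.+1, st.1 :: st.2))
  (I := fun x k st => st.1 = k /\ esize st.2 <= k * (size (l x)).+2 + 1)
  (m := fun x => (size (l x)).+1 + (size (l x) * (size (l x)).+2 + 1) + 1)) => //.
- by do ?[apply: polytime_succ | pt_step].
- by pt.
- have bsz : pbound (fun x => size (l x)).
    by apply: (pbound_le bl) => x; apply: ltnW; apply: size_le_esize.
  by pb.
- move=> x k [n w] a kl _ [/= -> Hw]; split=> //; rewrite esize_cons mulSn.
  by have := esize_nat_leS k; lia.
- move=> x k [n w] kl [/= -> Hw]; rewrite esize_pair.
  have := esize_nat_leS k.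
  have : k * (size (l x)).+2 <= size (l x) * (size (l x)).+2 by rewrite leq_mul2r kl orbT.
  by lia.
Qed.

Lemma polytime_nth X `{encodable X} A `{encodable A}
    (d : X -> A) (l : X -> seq A) (i : X -> nat) :
  polytime d -> polytime l -> polytime i ->
  polytime (fun x => nth (d x) (l x) (i x)).
Proof.
move=> Hd Hl Hi; have [bl _] := Hl; have [bd _] := Hd.
apply: (polytime_ext (f := fun x => (foldl (fun st a =>
    (st.1.+1, if st.1 == i x then a else st.2)) (0, d x) (l x)).2)).
  move=> x; have E (l0 : seq A) (z : nat) (w : A) :
      (foldl (fun st a => (st.1.+1, if st.1 == i x then a else st.2)) (z, w) l0).2 =
      (if i x < z then w else nth w l0 (i x - z)).
    elim: l0 z w => [|a l0 IH] z w /=; first by rewrite nth_nil; case: ifP.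
    rewrite IH ltnS; case: (ltngtP (i x) z) => [//|Hz|->]; last by rewrite subnn.
    by rewrite (_ : i x - z = (i x - z.+1).+1) //; lia.
  by rewrite E subn0.
apply: polytime_snd; apply: (polytime_foldl
  (f := fun x st a => (st.1.+1, if st.1 == i x then a else st.2))
  (I := fun x k st => st.1 = k /\ esize st.2 <= esize (d x) + esize (l x))
  (m := fun x => (esize (l x) + (esize (d x) + esize (l x))).+1)) => //.
- do ?[apply: polytime_succ | apply: polytime_eqn | pt_step].
  by apply: (polytime_comp (f := fun p => p.1.1) Hi); pt.
- by pt.
- by pb.
- by move=> x; split=> //; apply: leq_addr.
- move=> x k [n w] a kl Ha; pose proof (esize_In Ha) as al; move=> [/= -> Hw]; split=> //.
  by case: ifP => // _; lia.
- move=> x k [n w] kl [/= -> Hw]; rewrite esize_pair.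
  by have := esize_nat_leS k; pose proof (size_le_esize (l x)); lia.
Qed.

Lemma In_mem (T : eqType) (a : T) (l : seq T) : List.In a l -> a \in l.
Proof. by elim: l => //= b l IH [->|/IH]; rewrite inE ?eqxx // => ->; rewrite orbT. Qed.

(** * Bit lengths and powers of two *)

Definition halvings m := if m is 0 then 0 else (trunc_log 2 m).+1.
(** The candidate heights of boxes: 2, 4, and so on up to the least power of two above [m]; none for
    [m = 0]. *)
Definition pow2s m := [seq 2 ^ j.+1 | j <- iota 0 (halvings m)].

Lemma ltn_exp2_halvings m : m < 2 ^ halvings m.
Proof. by case: m => // m; apply: trunc_log_ltn. Qed.

Lemma ltn_halvings m j : (0 < m %/ 2 ^ j) = (j < halvings m).
Proof.
rewrite divn_gt0 ?expn_gt0 //; case: m => [|m]; first by rewrite leqn0 expn_eq0.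
rewrite /= ltnS; apply/idP/idP => [/(trunc_log_max (ltnSn 1)) //|Hj].
by apply: leq_trans (trunc_logP (ltnSn 1) (ltn0Sn m)); rewrite leq_exp2l.
Qed.

Lemma polytime_pow2s_id : polytime pow2s.
Proof.
(* The number is halved until it vanishes, one round per bit, while the current power of two
   doubles. *)
pose step (st : nat * (nat * seq nat)) := (st.1 %/ 2, (st.2.1 + st.2.1, st.2.1 :: st.2.2)).
have stepE m j : iter j step (m, (2, [::])) =
    (m %/ 2 ^ j, (2 ^ j.+1, rev [seq 2 ^ i.+1 | i <- iota 0 j])).
  elim: j => [|j IH]; first by rewrite divn1.
  have iotaSr : iota 0 j.+1 = rcons (iota 0 j) j by rewrite -addn1 iotaD cats1.
  rewrite iterS IH iotaSr map_rcons rev_rcons /step.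
  by rewrite -divnMA -expnSr addnn -mul2n -expnS.
apply: (polytime_ext (f := fun m => rev (iter (halvings m) step (m, (2, [::]))).2.2)).
  by move=> m; rewrite stepE revK.
have hE m : halvings m <= esize m by case: m.
apply: polytime_rev; do 2!apply: polytime_snd.
apply: (@polytime_while _ _ _ _ (fun st => 1 <= st.1) step _ halvings
  (fun m => (esize m + ((esize m).+3 + (esize m * (esize m).+3 + 1)).+1).+1)).
- by pt.
- by rewrite /step; pt.
- by pt.
- exact: (pbound_le (@pbound_esize nat _) hE).
- by pb.
- move=> m j /leq_trans/(_ (hE m)) Hj; rewrite stepE !esize_pair.
  have e1 : esize (m %/ 2 ^ j) <= esize m by apply: esize_nat_mono; apply: leq_div.
  have e2 : esize (2 ^ j.+1) <= (esize m).+2.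
    by apply: (@leq_trans j.+2); rewrite ?ltnS //; apply: esize_nat_le; rewrite ltn_exp2l.
  have e3 : esize (rev [seq 2 ^ i.+1 | i <- iota 0 j]) <= esize m * (esize m).+3 + 1.
    apply: leq_trans (esize_seq_le (m := (esize m).+2) _) _.
      move=> a /In_mem; rewrite mem_rev => /mapP[i]; rewrite mem_iota => /andP[_ ij] ->.
      apply: leq_trans (esize_nat_mono _) e2; rewrite leq_exp2l //; lia.
    by rewrite size_rev size_map size_iota leq_add2r leq_mul2r Hj orbT.
  by rewrite /= in e3 *; lia.
- by move=> m j _; rewrite stepE /= ltn_halvings.
Qed.

(** * The algorithm *)

Ltac pt_dp := fail.

Ltac pt_derived ::= match goal with
  | H : polytime ?f |- polytime (fun x => ?f (@?g x)) =>
      refine (polytime_comp (f := g) H _)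
  | |- polytime (fun x => S (@?f x)) => refine (polytime_succ (f := f) _)
  | |- polytime (fun x => @eq_op _ (@?f x) (@?g x)) =>
      refine (polytime_eqn (f := f) (g := g) _ _)
  | |- polytime (fun x => andb (@?f x) (@?g x)) =>
      refine (polytime_andb (f := f) (g := g) _ _)
  | |- polytime (fun x => negb (@?f x)) => refine (polytime_negb (f := f) _)
  | |- polytime (fun x => minn (@?f x) (@?g x)) =>
      refine (polytime_minn (f := f) (g := g) _ _)
  | |- polytime (fun x => cat (@?f x) (@?g x)) =>
      refine (polytime_cat (s := f) (t := g) _ _)
  | |- polytime (fun x => flatten (map (@?f x) (@?l x))) =>
      refine (polytime_flatmap (f := f) (l := l) _ _)
  | |- polytime (fun x => map (@?f x) (@?l x)) =>
      refine (polytime_map (f := f) (l := l) _ _)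
  | |- polytime (fun x => filter (@?f x) (@?l x)) =>
      refine (polytime_filter (f := f) (l := l) _ _)
  | |- polytime (fun x => sumn (@?l x)) => refine (polytime_sumn (l := l) _)
  | |- polytime (fun x => foldl muln 1 (@?l x)) => refine (polytime_prodn (l := l) _)
  | |- polytime (fun x => iota 0 (size (@?l x))) =>
      refine (polytime_indices (l := l) _)
  | |- polytime (fun x => size (@?l x)) => refine (polytime_size (l := l) _)
  | |- polytime (fun x => nth (@?d x) (@?l x) (@?i x)) =>
      refine (polytime_nth (d := d) (l := l) (i := i) _ _ _)
  | |- polytime (fun x => pow2s (@?f x)) =>
      refine (polytime_comp (f := f) polytime_pow2s_id _)
  | |- _ => pt_dp
  end.

(** Shaped so that its encoding is that of [enc_resource]: the inner pair is the encoded rational,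
    the final [unit] the end of the list. *)
Definition resource_data : Type := bool * (nat * (nat * (nat * ((nat * nat) * unit)))).

Definition rd_short (r : resource_data) := r.1.
Definition rd_start (r : resource_data) := r.2.1.
Definition rd_finish (r : resource_data) := r.2.2.1.
Definition rd_cap (r : resource_data) := r.2.2.2.1.
Definition rd_num (r : resource_data) := r.2.2.2.2.1.1.
Definition rd_den (r : resource_data) := r.2.2.2.2.1.2.

Definition rd0 : resource_data := (false, (0, (0, (0, ((0, 0), tt))))).

(** The product of all denominators clears them, and its size grows only with the sum of theirs. *)
Definition int_prices (rs : seq resource_data) : seq nat :=
  [seq rd_num r * (foldl muln 1 [seq rd_den r | r <- rs] %/ rd_den r) | r <- rs].

Definition item : Type := nat * (nat * (nat * (nat * (nat * nat)))).

Definition it_res (b : item) := b.1.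
Definition it_mult (b : item) := b.2.1.
Definition it_start (b : item) := b.2.2.1.
Definition it_finish (b : item) := b.2.2.2.1.
Definition it_height (b : item) := b.2.2.2.2.1.
Definition it_cost (b : item) := b.2.2.2.2.2.

Definition ceil_div a b := (a + (b - 1)) %/ b.

(* Code [0] stands for two copies, code [h > 0] for as many as reach height [h].
   A resource of capacity 0 yields height 0, as [x %/ 0 = 0]. *)
Definition box_mult w h := if h == 0 then 2 else ceil_div h w.

Definition make_item (rs : seq resource_data) (p : seq nat) (i a : nat) : item :=
  let r := nth rd0 rs i in
  (i, (a, (rd_start r, (rd_finish r, (a * rd_cap r, a * nth 0 p i))))).

Definition box_codes (d : seq nat) (rs : seq resource_data) : seq (nat * nat) :=
  [seq (i, h) | i <- [seq i <- iota 0 (size rs) | ~~ rd_short (nth rd0 rs i)],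
                h <- 0 :: pow2s (sumn d)].

Definition boxes d rs p : seq item :=
  [seq make_item rs p ih.1 (box_mult (rd_cap (nth rd0 rs ih.1)) ih.2)
  | ih <- box_codes d rs].

Definition short_items rs p : seq item :=
  [seq make_item rs p i 1 | i <- [seq i <- iota 0 (size rs) | rd_short (nth rd0 rs i)]].

(** Knapsack scaling for a guess [pmax] of the largest cost used: costlier items are dropped, and
    the other costs become integers of at most [a]. *)
Definition scaled (a pmax : nat) (l : seq item) : seq item :=
  [seq (it_res b, (it_mult b, (it_start b, (it_finish b,
         (it_height b, ceil_div (a * it_cost b) pmax)))))
  | b <- l & it_cost b <= pmax].

(* An entry [(g, x)] at key [((l, r), (h, c))] says: on the slots from [l] to [r - 1],
   above a base of height [h] already paid for, the copies [x] cover [g] units of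
   demand at a scaled cost of at most [c]. *)
Definition entry : Type := nat * seq nat.
Definition key : Type := (nat * nat) * (nat * nat).

Definition key_eq (k1 k2 : key) :=
  [&& k1.1.1 == k2.1.1, k1.1.2 == k2.1.2, k1.2.1 == k2.2.1 & k1.2.2 == k2.2.2].

(** Keys may repeat, for instance for boxes of equal height; this is harmless since the entries of a
    table are a function of the key. *)
Definition lookup (tb : seq (key * entry)) (k : key) (e : entry) : entry :=
  (foldl (fun acc ke => if key_eq k ke.1 then ke else acc) (k, e) tb).2.

Definition add_copies (x y : seq nat) :=
  [seq nth 0 x i + nth 0 y i | i <- iota 0 (size x)].

Definition raise_copies (x : seq nat) (j a : nat) :=
  [seq nth 0 x i + (if i == j then a else 0) | i <- iota 0 (size x)].

Definition dp_data : Type :=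
  seq nat * (seq nat * (seq item * (seq item * (seq nat * seq key)))).

Definition dp_demands (E : dp_data) := E.1.
Definition dp_zeros (E : dp_data) := E.2.1.
Definition dp_boxes (E : dp_data) := E.2.2.1.
Definition dp_shorts (E : dp_data) := E.2.2.2.1.
Definition dp_budgets (E : dp_data) := E.2.2.2.2.1.
Definition dp_keys (E : dp_data) := E.2.2.2.2.2.

(* Missing keys read as the empty solution, which is sound everywhere. *)
Definition dp_get (E : dp_data) tb k : entry := lookup tb k (0, dp_zeros E).

(** Short resources are bought only here, at most one above the base of a single slot; this enforces
    the bound of one per slot. *)
Definition slot_entries (E : dp_data) (k : key) : seq entry :=
  if k.1.2 == k.1.1.+1 then
    (minn (nth 0 (dp_demands E) k.1.1) k.2.1, dp_zeros E) ::
    [seq (minn (nth 0 (dp_demands E) k.1.1) (k.2.1 + it_height b),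
          raise_copies (dp_zeros E) (it_res b) 1)
    | b <- dp_shorts E & (it_start b == k.1.1) && (it_cost b <= k.2.2)]
  else [::].

(** A box spanning the interval replaces the base by its own height instead of adding to it: boxes
    are combined by maximum. *)
Definition box_entries (E : dp_data) tb (k : key) : seq entry :=
  [seq ((dp_get E tb (k.1, (it_height b, k.2.2 - it_cost b))).1,
        raise_copies (dp_get E tb (k.1, (it_height b, k.2.2 - it_cost b))).2
          (it_res b) (it_mult b))
  | b <- dp_boxes E
  & [&& it_start b <= k.1.1, k.1.2 <= (it_finish b).+1 & it_cost b <= k.2.2]].

Definition split_entries (E : dp_data) tb (k : key) : seq entry :=
  [seq ((dp_get E tb ((k.1.1, mc.1), (k.2.1, mc.2))).1 +
        (dp_get E tb ((mc.1, k.1.2), (k.2.1, k.2.2 - mc.2))).1,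
        add_copies (dp_get E tb ((k.1.1, mc.1), (k.2.1, mc.2))).2
          (dp_get E tb ((mc.1, k.1.2), (k.2.1, k.2.2 - mc.2))).2)
  | mc <- [seq (m, c) | m <- iota 0 (size (0 :: dp_demands E)), c <- dp_budgets E]
  & [&& k.1.1 <= mc.1, mc.1 <= k.1.2 & mc.2 <= k.2.2]].

Definition best_entry (e : entry) (es : seq entry) : entry :=
  foldl (fun acc e' => if acc.1 <= e'.1 then e' else acc) e es.

Definition dp_entry (E : dp_data) tb (k : key) : entry :=
  best_entry (dp_get E tb k)
    (slot_entries E k ++ (box_entries E tb k ++ split_entries E tb k)).

Definition dp_step (E : dp_data) tb : seq (key * entry) :=
  [seq (k, dp_entry E tb k) | k <- dp_keys E].

(** The list of budgets acts as a unary counter of rounds, long enough for the recursion depth in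
    [dp_complete]. *)
Definition dp_table (E : dp_data) : seq (key * entry) :=
  foldl (fun tb _ => dp_step E tb) [::] (dp_budgets E).

(** * Running time of the dynamic program *)

Section PolytimeDP.
Context {X : Type} `{encodable X}.

Lemma polytime_raise_copies (x : X -> seq nat) (j a : X -> nat) :
  polytime x -> polytime j -> polytime a -> polytime (fun t => raise_copies (x t) (j t) (a t)).
Proof. by rewrite /raise_copies => Hx Hj Ha; pt. Qed.

Lemma polytime_add_copies (x y : X -> seq nat) :
  polytime x -> polytime y -> polytime (fun t => add_copies (x t) (y t)).
Proof. by rewrite /add_copies => Hx Hy; pt. Qed.

Lemma polytime_lookup (tb : X -> seq (key * entry)) (k : X -> key) (e : X -> entry) :
  polytime tb -> polytime k -> polytime e ->
  polytime (fun t => lookup (tb t) (k t) (e t)).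
Proof.
rewrite /lookup => Htb Hk He; apply: polytime_snd.
apply: (polytime_select (R := fun t acc ke => key_eq (k t) ke.1) (z := fun t => (k t, e t)));
  rewrite /key_eq; pt.
Qed.

Lemma polytime_best_entry (e : X -> entry) (es : X -> seq entry) :
  polytime e -> polytime es -> polytime (fun t => best_entry (e t) (es t)).
Proof.
move=> He Hes.
by apply: (polytime_select (R := fun t (acc e' : entry) => acc.1 <= e'.1)) => //; pt.
Qed.

End PolytimeDP.

Ltac pt_dp ::= match goal with
  | |- polytime (fun x => raise_copies (@?f x) (@?g x) (@?h x)) =>
      refine (polytime_raise_copies (x := f) (j := g) (a := h) _ _ _)
  | |- polytime (fun x => add_copies (@?f x) (@?g x)) =>
      refine (polytime_add_copies (x := f) (y := g) _ _)
  | |- polytime (fun x => lookup (@?f x) (@?g x) (@?h x)) =>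
      refine (polytime_lookup (tb := f) (k := g) (e := h) _ _ _)
  | |- polytime (fun x => best_entry (@?f x) (@?g x)) =>
      refine (polytime_best_entry (e := f) (es := g) _ _)
  end.

Lemma polytime_dp_entry :
  polytime (fun p : (dp_data * seq (key * entry)) * key => dp_entry p.1.1 p.1.2 p.2).
Proof.
rewrite /dp_entry /slot_entries /box_entries /split_entries /dp_get.
rewrite /dp_demands /dp_zeros /dp_boxes /dp_shorts /dp_budgets.
rewrite /it_res /it_mult /it_start /it_finish /it_height /it_cost.
by pt.
Qed.

Lemma foldl_select_mem (T : eqType) (R : T -> T -> bool) (z : T) l :
  foldl (fun acc a => if R acc a then a else acc) z l \in z :: l.
Proof.
elim: l z => [|a l IH] z /=; first by rewrite mem_head.
have := IH (if R z a then a else z); rewrite !inE.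
by case: ifP => _ /orP[->|->]; rewrite ?orbT.
Qed.

Lemma lookup_mem tb (k : key) e :
  lookup tb k e = e \/ exists2 ke, ke \in tb & lookup tb k e = ke.2 /\ key_eq k ke.1.
Proof.
rewrite /lookup; elim/last_ind: tb => [|tb ke IH]; first by left.
rewrite foldl_rcons; case: ifP => [kke|_].
  by right; exists ke; rewrite ?mem_rcons ?mem_head.
case: IH => [->|[ke' Hke' E]]; first by left.
by right; exists ke'; rewrite ?mem_rcons ?inE ?Hke' ?orbT.
Qed.

Definition entry_bounded (B m : nat) (e : entry) :=
  [/\ e.1 <= B, size e.2 = m & forall x, x \in e.2 -> x <= B].

Lemma entry_bounded_le B B' m e : B <= B' -> entry_bounded B m e -> entry_bounded B' m e.
Proof.
move=> BB [e1 e2 e3]; split=> //; first exact: leq_trans BB.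
by move=> x /e3/leq_trans; apply.
Qed.

Lemma nth_bounded B m e i : entry_bounded B m e -> nth 0 e.2 i <= B.
Proof.
move=> [_ _ e3]; case: (ltnP i (size e.2)) => Hi; last by rewrite nth_default.
by apply: e3; apply: mem_nth.
Qed.

Lemma raise_copies_bounded B C m e g j a :
  entry_bounded B m e -> g <= B + C -> a <= C ->
  entry_bounded (B + C) m (g, raise_copies e.2 j a).
Proof.
move=> eB gB aC; have [e1 e2 e3] := eB; split=> //=.
  by rewrite size_map size_iota.
move=> x /mapP[i _ ->]; have := nth_bounded i eB; case: ifP; lia.
Qed.

Lemma add_copies_bounded B m e e' :
  entry_bounded B m e -> entry_bounded B m e' ->
  entry_bounded (B + B) m (e.1 + e'.1, add_copies e.2 e'.2).
Proof.
move=> eB eB'; have [e1 e2 e3] := eB; have [e1' e2' e3'] := eB'; split=> /=.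
- by rewrite leq_add.
- by rewrite size_map size_iota.
- by move=> x /mapP[i _ ->]; rewrite leq_add // (nth_bounded _ eB, nth_bounded _ eB').
Qed.

Lemma esize_it_mult (l : seq item) b : b \in l -> esize (it_mult b) < esize l.
Proof.
move=> bl; have : esize b < esize l by exact: esize_mem.
case: b {bl} => [i [a r]]; rewrite /it_mult !esize_pair /=.
by lia.
Qed.

Lemma entry_bounded_zeros (E : dp_data) B :
  2 ^ esize E <= B -> entry_bounded B (size (dp_zeros E)) (0, dp_zeros E).
Proof.
case: E => [d [z r]] EB; split=> //= x xz; apply: leq_trans EB.
apply: (leq_trans (ltnW (ltn_exp2_esize x))).
by rewrite leq_exp2l // !esize_pair; have : esize x < esize z by [exact: esize_mem]; lia.
Qed.

(** A new entry adds at most two numbers bounded by [B]. So numbers gain at most two bits per round,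
    and polynomially many rounds keep them polynomially small. *)
Lemma dp_entry_bounded (E : dp_data) tb k B :
  2 ^ esize E <= B ->
  (forall ke, ke \in tb -> entry_bounded B (size (dp_zeros E)) ke.2) ->
  entry_bounded (B * 4) (size (dp_zeros E)) (dp_entry E tb k).
Proof.
move=> EB tbB; have zB := entry_bounded_zeros EB.
have getB k' : entry_bounded B (size (dp_zeros E)) (dp_get E tb k').
  rewrite /dp_get; case: (lookup_mem tb k' (0, dp_zeros E)) => [->//|[ke ketb [-> _]]].
  exact: tbB.
have B4 : B <= B * 4 by lia.
have BB4 : B + B <= B * 4 by lia.
have dB i : nth 0 (dp_demands E) i <= B.
  case: (ltnP i (size (dp_demands E))) => Hi; last by rewrite nth_default.
  apply: leq_trans EB; apply: (leq_trans (ltnW (ltn_exp2_esize _))).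
  rewrite leq_exp2l //; have : esize (nth 0 (dp_demands E) i) < esize (dp_demands E).
    exact/esize_mem/mem_nth.
  by case: (E) => d r; rewrite esize_pair /dp_demands /=; lia.
have aB b : b \in dp_boxes E -> it_mult b <= B.
  move=> /esize_it_mult bE; apply: leq_trans EB.
  apply: (leq_trans (ltnW (ltn_exp2_esize _))); rewrite leq_exp2l //.
  move: bE; case: (E) => [d [z [bx r]]]; rewrite !esize_pair /dp_boxes /=; lia.
have B1 : 1 <= B by apply: leq_trans EB; rewrite expn_gt0.
have := foldl_select_mem (fun acc e' : entry => acc.1 <= e'.1) (dp_get E tb k)
  (slot_entries E k ++ (box_entries E tb k ++ split_entries E tb k)).
rewrite -/(best_entry _ _) -/(dp_entry E tb k) inE !mem_cat => /orP[/eqP ->|].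
  exact: entry_bounded_le (getB k).
case/orP => [|/orP[]].
- rewrite /slot_entries; case: ifP => // _; rewrite inE => /orP[/eqP ->|].
    by have [? ? ?] := entry_bounded_le B4 zB; split=> //=; rewrite geq_min (leq_trans (dB _)).
  case/mapP => b _ ->; apply: (entry_bounded_le BB4).
  apply: (raise_copies_bounded _ zB) => //.
  by rewrite geq_min (leq_trans (dB _)) // leq_addr.
- case/mapP => b; rewrite mem_filter => /andP[_ /aB bB] ->; apply: (entry_bounded_le BB4).
  apply: raise_copies_bounded => //.
  by apply: leq_trans (leq_addr _ _); case: (getB (k.1, (it_height b, k.2.2 - it_cost b))).
- case/mapP => mc _ ->; apply: (entry_bounded_le BB4); exact: add_copies_bounded.
Qed.

Lemma polytime_dp_table : polytime dp_table.
Proof.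
(* The factor 4 per round gives [2 * k] extra bits after [k] rounds. *)
pose (B := fun (E : dp_data) k => 2 ^ (esize E + 2 * k)).
pose I (E : dp_data) k (tb : seq (key * entry)) := size tb <= size (dp_keys E) /\
  forall ke, ke \in tb -> ke.1 \in dp_keys E /\
    entry_bounded (B E k) (size (dp_zeros E)) ke.2.
pose (e := fun E : dp_data => (esize E + 2 * esize E).+2).
pose (me := fun E : dp_data => (e E + (esize E * (e E).+1 + 1)).+1).
have be : pbound e by rewrite /e; pb.
apply: (@polytime_foldl _ _ _ _ _ _ (fun E tb _ => dp_step E tb) _ _ I
  (fun E => esize E * ((esize E + me E).+2) + 1)).
- rewrite /dp_step; apply: (@polytime_map _ _ _ _ _ _
    (fun p : (dp_data * seq (key * entry)) * nat =>
       fun k => (k, dp_entry p.1.1 p.1.2 k))); last by rewrite /dp_keys; pt.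
  apply: polytime_pair; first by pt.
  by apply: (polytime_comp (f := fun q => ((q.1.1.1, q.1.1.2), q.2)) polytime_dp_entry); pt.
- by pt.
- by rewrite /dp_budgets; pt.
- by rewrite /me; pb.
- by move=> E; split.
- move=> E k tb c _ _ [_ tbI]; split; first by rewrite size_map.
  move=> _ /mapP[k' k'E ->]; split=> //=.
  have -> : B E k.+1 = B E k * 4 by rewrite /B mulnS addnCA expnD mulnC.
  apply: dp_entry_bounded; last by move=> ke /tbI[].
  by rewrite leq_exp2l // leq_addr.
- move=> E k tb kl [tbs tbI].
  have keysE : esize (dp_keys E) < esize E.
    by case: (E) => [? [? [? [? [? ?]]]]]; rewrite !esize_pair /dp_keys /=; lia.
  have zE : esize (dp_zeros E) < esize E.
    by case: (E) => [? [? r]]; rewrite !esize_pair /dp_zeros /=; lia.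
  have bE : esize (dp_budgets E) < esize E.
    by case: (E) => [? [? [? [? [? ?]]]]]; rewrite !esize_pair /dp_budgets /=; lia.
  have kE : k <= esize E.
    by apply: (leq_trans kl); pose proof (size_le_esize (dp_budgets E)); lia.
  have numE x : x <= B E k -> esize x <= e E.
    move=> xB; apply: (leq_trans (esize_nat_mono xB)).
    by rewrite esize_nat trunc_expnK // /e; lia.
  have mono a b c : a <= b -> a * c <= b * c by move=> ab; rewrite leq_mul2r ab orbT.
  apply: (@leq_trans (size tb * (esize E + me E).+2 + 1)); last first.
    rewrite leq_add2r; apply: mono; apply: (leq_trans tbs).
    by pose proof (size_le_esize (dp_keys E)); lia.
  apply: esize_seq_le => -[k' [g x]] /In_mem /tbI[/= k'E [/= g1 xs xB]].
  rewrite !esize_pair; have : esize k' < esize (dp_keys E) by exact: esize_mem.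
  have := numE g g1.
  have : esize x <= esize E * (e E).+1 + 1.
    apply: (@leq_trans (size x * (e E).+1 + 1)).
      by apply: esize_seq_le => y /In_mem/xB/numE.
    rewrite leq_add2r; apply: mono; rewrite xs.
    by pose proof (size_le_esize (dp_zeros E)); lia.
  by rewrite /me; lia.
Qed.

(** * Assembling the algorithm *)

Definition copies_cost (p x : seq nat) :=
  sumn [seq nth 0 x i * nth 0 p i | i <- iota 0 (size x)].

(** The default [z] is returned only if there are no candidates, which [exists_cheap_entry] excludes
    on feasible instances. *)
Definition cheapest (p : seq nat) (z : seq nat) (xs : seq (seq nat)) :=
  if xs is x :: xs' then
    foldl (fun acc y => if copies_cost p y <= copies_cost p acc then y else acc) x xs'
  else z.

(* Only the length matters: it exceeds the number of items in any solution that
   uses each box at most once and at most one short resource per timeslot.  Unary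
   numbers, given as lists, bound all loops. *)
Definition item_bound (d : seq nat) (bx : seq item) : seq nat :=
  0 :: ([seq 0 | _ <- bx] ++ [seq 0 | _ <- d]).

(** With [N = size nl] these are 0, ..., [8 * (N * N)]: fewer than [N] items of scaled cost at most
    [7 * N] each fit in. *)
Definition budgets (nl : seq nat) : seq nat :=
  iota 0 (size (0 :: [seq 0 | _ <- [:: 0; 0; 0; 0; 0; 0; 0; 0],
                              _ <- [seq 0 | _ <- nl, _ <- nl]])).

Definition all_keys (d : seq nat) (bx : seq item) (bl : seq nat) : seq key :=
  [seq (lr, hc) | lr <- [seq (l, r) | l <- iota 0 (size (0 :: d)),
                                      r <- iota 0 (size (0 :: d))],
                  hc <- [seq (h, c) | h <- 0 :: [seq it_height b | b <- bx], c <- bl]].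

Definition dp_input (d : seq nat) (rs : seq resource_data) (bx sh : seq item)
    (pmax : nat) : dp_data :=
  (d, ([seq 0 | _ <- rs],
   (scaled (7 * size (item_bound d bx)) pmax bx,
   (scaled (7 * size (item_bound d bx)) pmax sh,
   (budgets (item_bound d bx), all_keys d bx (budgets (item_bound d bx))))))).

Definition final_entries (k T : nat) (E : dp_data) : seq entry :=
  [seq e <- [seq dp_get E (dp_table E) ((0, T), (0, c)) | c <- dp_budgets E]
  | k <= e.1].

(** The largest item cost of a good solution is unknown, so each item cost is tried; 0 is for
    solutions with free items only. *)
Definition all_entries d rs bx sh k : seq entry :=
  flatten [seq final_entries k (size d) (dp_input d rs bx sh pmax)
          | pmax <- 0 :: [seq it_cost b | b <- bx ++ sh]].

Definition choose_copies d rs k p : seq nat :=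
  cheapest p [seq 0 | _ <- rs]
    [seq e.2 | e <- all_entries d rs (boxes d rs p) (short_items rs p) k].

Definition covered (rs : seq resource_data) (x : seq nat) (t : nat) : nat :=
  sumn [seq if (rd_start (nth rd0 rs i) <= t) && (t <= rd_finish (nth rd0 rs i))
            then nth 0 x i * rd_cap (nth rd0 rs i) else 0 | i <- iota 0 (size rs)].

Definition coverage_list d rs x : seq nat :=
  [seq minn (nth 0 d t) (covered rs x t) | t <- iota 0 (size d)].

Definition lspc_data : Type := seq nat * (seq resource_data * (nat * unit)).

Definition lspc_algorithm (I : lspc_data) : seq nat * (seq nat * unit) :=
  let d := I.1 in let rs := I.2.1 in let k := I.2.2.1 in
  let x := choose_copies d rs k (int_prices rs) in
  (x, (coverage_list d rs x, tt)).

(** * Running time of the algorithm *)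

Lemma polytime_cheapest X `{encodable X} (p z : X -> seq nat) (xs : X -> seq (seq nat)) :
  polytime p -> polytime z -> polytime xs ->
  polytime (fun t => cheapest (p t) (z t) (xs t)).
Proof.
move=> Hp Hz Hxs; rewrite /cheapest.
apply: (polytime_seq_case (g := fun q : X * (seq nat * seq (seq nat)) =>
  foldl (fun acc y => if copies_cost (p q.1) y <= copies_cost (p q.1) acc then y else acc)
    q.2.1 q.2.2)) => //.
apply: (polytime_select
  (R := fun (q : X * (seq nat * seq (seq nat))) acc y =>
          copies_cost (p q.1) y <= copies_cost (p q.1) acc)); rewrite /copies_cost; pt.
Qed.

Lemma polytime_make_item X `{encodable X} (rs : X -> seq resource_data)
    (p : X -> seq nat) (i a : X -> nat) :
  polytime rs -> polytime p -> polytime i -> polytime a ->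
  polytime (fun t => make_item (rs t) (p t) (i t) (a t)).
Proof.
move=> Hrs Hp Hi Ha; rewrite /make_item /rd_start /rd_finish /rd_cap /rd0; pt.
Qed.

Lemma polytime_boxes X `{encodable X} (d : X -> seq nat)
    (rs : X -> seq resource_data) (p : X -> seq nat) :
  polytime d -> polytime rs -> polytime p ->
  polytime (fun t => boxes (d t) (rs t) (p t)).
Proof.
move=> Hd Hrs Hp; rewrite /boxes /box_codes /box_mult /ceil_div.
apply: (polytime_map
  (f := fun t ih => make_item (rs t) (p t) ih.1 (if ih.2 == 0 then 2
     else (ih.2 + (rd_cap (nth rd0 (rs t) ih.1) - 1))
       %/ rd_cap (nth rd0 (rs t) ih.1)))); last first.
  by rewrite /rd_short /rd0; pt.
by apply: polytime_make_item; rewrite /rd_cap /rd0; pt.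
Qed.

Lemma polytime_short_items X `{encodable X} (rs : X -> seq resource_data) (p : X -> seq nat) :
  polytime rs -> polytime p -> polytime (fun t => short_items (rs t) (p t)).
Proof.
move=> Hrs Hp; rewrite /short_items.
apply: (polytime_map (f := fun t i => make_item (rs t) (p t) i 1)); last first.
  by rewrite /rd_short /rd0; pt.
by apply: polytime_make_item; pt.
Qed.

Lemma polytime_int_prices X `{encodable X} (rs : X -> seq resource_data) :
  polytime rs -> polytime (fun t => int_prices (rs t)).
Proof. by move=> Hrs; rewrite /int_prices /rd_num /rd_den; pt. Qed.

Lemma polytime_dp_input X `{encodable X} (d : X -> seq nat) (rs : X -> seq resource_data)
    (bx sh : X -> seq item) (pmax : X -> nat) :
  polytime d -> polytime rs -> polytime bx -> polytime sh -> polytime pmax ->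
  polytime (fun t => dp_input (d t) (rs t) (bx t) (sh t) (pmax t)).
Proof.
move=> Hd Hrs Hbx Hsh Hpmax.
rewrite /dp_input /scaled /all_keys /budgets /item_bound /ceil_div.
rewrite /it_res /it_mult /it_start /it_finish /it_height /it_cost.
by pt.
Qed.

Lemma polytime_final_entries X `{encodable X} (k T : X -> nat) (E : X -> dp_data) :
  polytime k -> polytime T -> polytime E ->
  polytime (fun t => final_entries (k t) (T t) (E t)).
Proof.
move=> Hk HT HE; rewrite /final_entries /dp_get /dp_zeros /dp_budgets.
have Htb : polytime (fun t => dp_table (E t)).
  exact: (polytime_comp polytime_dp_table HE).
apply: (polytime_filter (f := fun t (e : entry) => k t <= e.1)); first by pt.
apply: (polytime_map (f := fun t c => lookup (dp_table (E t)) (0, T t, (0, c))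
  (0, (E t).2.1))); last by pt.
apply: polytime_lookup; try by pt.
by apply: (polytime_comp (f := fun p : X * nat => p.1) Htb); pt.
Qed.

Lemma polytime_all_entries X `{encodable X} (d : X -> seq nat) (rs : X -> seq resource_data)
    (bx sh : X -> seq item) (k : X -> nat) :
  polytime d -> polytime rs -> polytime bx -> polytime sh -> polytime k ->
  polytime (fun t => all_entries (d t) (rs t) (bx t) (sh t) (k t)).
Proof.
move=> Hd Hrs Hbx Hsh Hk; rewrite /all_entries.
apply: (polytime_flatmap (f := fun t pmax =>
  final_entries (k t) (size (d t)) (dp_input (d t) (rs t) (bx t) (sh t) pmax))).
  by apply: polytime_final_entries; [pt|pt|apply: polytime_dp_input; pt].
by rewrite /it_cost; pt.
Qed.

Lemma polytime_lspc_algorithm : polytime lspc_algorithm.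
Proof.
have Hx : polytime (fun I : lspc_data => choose_copies I.1 I.2.1 I.2.2.1 (int_prices I.2.1)).
  have Hp : polytime (fun I : lspc_data => int_prices I.2.1).
    by apply: polytime_int_prices; pt.
  rewrite /choose_copies; apply: polytime_cheapest => //; first by pt.
  apply: (polytime_map (f := fun _ e => e.2)); first by pt.
  apply: polytime_all_entries; try by pt.
    by apply: polytime_boxes => //; pt.
  by apply: polytime_short_items => //; pt.
rewrite /lspc_algorithm /coverage_list; apply: polytime_pair => //.
apply: polytime_pair; last by pt.
rewrite /covered /rd_start /rd_finish /rd_cap /rd0.
apply: (polytime_map (f := fun I t => minn (nth 0 I.1 t)
 (sumn [seq if (rd_start (nth rd0 I.2.1 i) <= t) && (t <= rd_finish (nth rd0 I.2.1 i))
    then nth 0 (choose_copies I.1 I.2.1 I.2.2.1 (int_prices I.2.1)) i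
         * rd_cap (nth rd0 I.2.1 i) else 0 | i <- iota 0 (size I.2.1)]))); last by pt.
apply: polytime_minn; first by pt.
apply: polytime_sumn.
apply: (polytime_map (f := fun (q : lspc_data * nat) i =>
  if (rd_start (nth rd0 q.1.2.1 i) <= q.2) && (q.2 <= rd_finish (nth rd0 q.1.2.1 i))
  then nth 0 (choose_copies q.1.1 q.1.2.1 q.1.2.2.1 (int_prices q.1.2.1)) i
       * rd_cap (nth rd0 q.1.2.1 i) else 0)); last by pt.
rewrite /rd_start /rd_finish /rd_cap /rd0; apply: polytime_if; [by pt| |by pt].
apply: polytime_mul; last by pt.
apply: polytime_nth; try by pt.
by apply: (polytime_comp (f := fun q : (lspc_data * nat) * nat => q.1.1) Hx); pt.
Qed.

(** * Completeness of the dynamic program *)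

Lemma key_eq_eq (k1 k2 : key) : key_eq k1 k2 -> k1 = k2.
Proof.
case: k1 k2 => [[a b] [c d]] [[a' b'] [c' d']].
by case/and4P => /eqP/= -> /eqP/= -> /eqP/= -> /eqP/= ->.
Qed.

Lemma lookup_map (F : key -> entry) (ks : seq key) k e :
  k \in ks -> lookup [seq (k', F k') | k' <- ks] k e = F k.
Proof.
rewrite /lookup; elim/last_ind: ks => // ks k' IH.
rewrite mem_rcons inE map_rcons foldl_rcons.
case: ifP => [/key_eq_eq -> //|kk'] /orP[/eqP kE|/IH //].
by move: kk'; rewrite kE /key_eq /= !eqxx.
Qed.

Lemma best_entry_ge (e : entry) es a : a \in e :: es -> a.1 <= (best_entry e es).1.
Proof.
have best_ge es0 (e0 : entry) : e0.1 <= (best_entry e0 es0).1.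
  elim: es0 e0 => //= b es0 IH e0; case: ifP => // H.
  exact: leq_trans H (IH b).
rewrite inE => /orP[/eqP -> //|]; elim: es e => //= b es IH e.
rewrite inE => /orP[/eqP ->|aes]; last exact: IH.
by apply: leq_trans (best_ge es _); case: ifP => // /negbT; rewrite -ltnNge; apply: ltnW.
Qed.

Lemma exists_lowest (B : seq item) : B != [::] ->
  exists2 b, b \in B & forall b', b' \in B -> it_height b <= it_height b'.
Proof.
elim: B => // a [|a' B] IH _.
  by exists a; rewrite ?mem_head // => b'; rewrite inE => /eqP ->.
have [//|b bB Hb] := IH; case: (leqP (it_height a) (it_height b)) => Hab.
  exists a; rewrite ?mem_head // => b'; rewrite inE => /orP[/eqP -> //|/Hb].
  exact: leq_trans.
exists b; first by rewrite inE bB orbT.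
by move=> b'; rewrite inE => /orP[/eqP ->|/Hb //]; apply: ltnW.
Qed.

Section Completeness.
Variables (E : dp_data) (hs : seq nat) (K : nat).

Let T := size (dp_demands E).
Let d := nth 0 (dp_demands E).
Let tables j := iter j (dp_step E) [::].
Let D j l r h c := (dp_get E (tables j) ((l, r), (h, c))).1.

Hypothesis keysP : forall l r h c,
  l <= T -> r <= T -> h \in hs -> c < K -> ((l, r), (h, c)) \in dp_keys E.
Hypothesis budgetsE : dp_budgets E = iota 0 K.
Hypothesis heightsP : forall b, b \in dp_boxes E -> it_height b \in hs.

Lemma dp_get_step j l r h c a : l <= T -> r <= T -> h \in hs -> c < K ->
  a \in dp_get E (tables j) ((l, r), (h, c)) ::
    (slot_entries E ((l, r), (h, c)) ++
     (box_entries E (tables j) ((l, r), (h, c)) ++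
      split_entries E (tables j) ((l, r), (h, c)))) ->
  a.1 <= D j.+1 l r h c.
Proof.
move=> lT rT hh cK aP; rewrite /D /tables iterS /dp_step {1}/dp_get lookup_map.
  exact: best_entry_ge.
exact: keysP.
Qed.

Lemma dp_slot_long j l h c : l < T -> h \in hs -> c < K ->
  minn (d l) h <= D j.+1 l l.+1 h c.
Proof.
move=> lT hh cK; apply: (dp_get_step (a := (minn (d l) h, dp_zeros E))) => //.
  exact: ltnW.
by rewrite inE !mem_cat /slot_entries /= eqxx !inE eqxx /= !orbT.
Qed.

Lemma dp_slot_short j l h c b : l < T -> h \in hs -> c < K ->
  b \in dp_shorts E -> it_start b = l -> it_cost b <= c ->
  minn (d l) (h + it_height b) <= D j.+1 l l.+1 h c.
Proof.
move=> lT hh cK bE bl bc; apply: (dp_get_step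
  (a := (minn (d l) (h + it_height b), raise_copies (dp_zeros E) (it_res b) 1))) => //.
  exact: ltnW.
rewrite inE !mem_cat /slot_entries /= eqxx inE; apply/orP; right; apply/orP; left.
apply/orP; right; apply/mapP; exists b => //.
by rewrite mem_filter /= bl eqxx bc.
Qed.

Lemma dp_box j l r h c b : l <= T -> r <= T -> h \in hs -> c < K ->
  b \in dp_boxes E -> it_start b <= l -> r <= (it_finish b).+1 -> it_cost b <= c ->
  D j l r (it_height b) (c - it_cost b) <= D j.+1 l r h c.
Proof.
move=> lT rT hh cK bE bl br bc.
apply: (dp_get_step (a := (_, raise_copies
  (dp_get E (tables j) ((l, r), (it_height b, c - it_cost b))).2
  (it_res b) (it_mult b)))) => //.
rewrite inE !mem_cat; apply/orP; right; apply/orP; right; apply/orP; left.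
by apply/mapP; exists b => //; rewrite mem_filter /= bl br bc.
Qed.

Lemma dp_split j l m r h c c' : l <= m -> m <= r -> r <= T -> h \in hs ->
  c' <= c -> c < K ->
  D j l m h c' + D j m r h (c - c') <= D j.+1 l r h c.
Proof.
move=> lm mr rT hh cc cK.
apply: (dp_get_step (a := (_, add_copies
  (dp_get E (tables j) ((l, m), (h, c'))).2
  (dp_get E (tables j) ((m, r), (h, c - c'))).2))) => //; try lia.
rewrite inE !mem_cat; apply/orP; right; apply/orP; right; apply/orP; right.
apply/mapP; exists (m, c') => //; rewrite mem_filter; apply/andP; split.
  by rewrite /= lm mr cc.
apply/allpairsPdep; exists m, c'; split=> //; rewrite ?budgetsE mem_iota.
  by rewrite /= -/T; lia.
by lia.
Qed.

(** The comparison solution uses at slot [t] a short resource of height [ws t], for which the cost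
    [us t] is set aside; height 0 calls for no purchase. *)
Variables (ws us : nat -> nat).
Hypothesis shortsP : forall t, t < T -> ws t = 0 \/
  exists2 b, b \in dp_shorts E &
    [/\ it_start b = t, it_height b = ws t & it_cost b <= us t].

Lemma dp_complete_slots n j l h c (e : nat -> nat) : l + n <= T -> n <= j ->
  h \in hs -> c < K -> (forall t, l <= t < l + n -> e t <= h) ->
  \sum_(l <= t < l + n) us t <= c ->
  \sum_(l <= t < l + n) minn (d t) (e t + ws t) <= D j l (l + n) h c.
Proof.
elim: n j l c => [|n IH] j l c lT nj hh cK eh uc; first by rewrite addn0 big_geq.
case: j nj => // j nj.
have slot j' c' : c' < K -> us l <= c' -> minn (d l) (e l + ws l) <= D j'.+1 l l.+1 h c'.
  move=> c'K uc'; have el : e l <= h by apply: eh; lia.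
  case: (@shortsP l) => [|->|[b bE [bl bw bu]]]; first lia.
    rewrite addn0; apply: leq_trans (dp_slot_long _ _ _ _) => //; last lia.
    by rewrite leq_min geq_minl (leq_trans (geq_minr _ _) el).
  have lT' : l < T by lia.
  apply: leq_trans (dp_slot_short j' lT' hh c'K bE bl (leq_trans bu uc')).
  by rewrite leq_min geq_minl (leq_trans (geq_minr _ _)) // bw leq_add2r.
rewrite big_ltn in uc *; try lia.
rewrite big_ltn; last lia.
case: n IH lT nj uc eh => [|n] IH lT nj uc eh.
  by rewrite addn1 big_geq // addn0; apply: slot => //; lia.
have ucl : us l <= c by lia.
have lnE : l.+1 + n.+1 = l + n.+2 by lia.
apply: leq_trans (@dp_split j l l.+1 (l + n.+2) h c (us l) _ _ _ hh ucl cK); try lia.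
apply: leq_add.
  by case: j nj => // j nj; apply: slot => //; lia.
rewrite -lnE; apply: IH => //; try lia.
  by move=> t ht; apply: eh; lia.
by rewrite lnE; lia.
Qed.

Definition holds (b : item) (t : nat) := it_start b <= t <= it_finish b.

(* Boxes are opened from the lowest one upwards.  The lowest box is shrunk to the
   hull of the slots that it alone covers; no other box contains an endpoint of
   the hull, so the others lie left of it, inside it or right of it. *)
Lemma dp_complete m (B : seq item) j l r h c (e : nat -> nat) :
  size B <= m -> {subset B <= dp_boxes E} -> l <= r -> r <= T ->
  h \in hs -> c < K -> 3 * m + (r - l) <= j ->
  (forall t, l <= t < r -> e t <= h \/
     exists2 b, b \in B & holds b t && (e t <= it_height b)) ->
  \sum_(b <- B) it_cost b + \sum_(l <= t < r) us t <= c ->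
  \sum_(l <= t < r) minn (d t) (e t + ws t) <= D j l r h c.
Proof.
(* Opening a box takes three rounds, two splits and the box itself; [r - l] rounds are left for
   single slots. *)
elim: m B j l r h c => [|m IH] B j l r h c Bm BE lr rT hh cK jm eB uc.
  have B0 : B = [::] by case: (B) Bm.
  rewrite -(subnKC lr); apply: dp_complete_slots => //; rewrite ?subnKC //; try lia.
    by move=> t /eB[//|[b]]; rewrite B0.
case: (eqVneq B [::]) => [B0|Bn].
  by subst B; apply: (IH [::]) => //; lia.
have [b bB blow] := exists_lowest Bn.
have pB := perm_to_rem bB; set B' := rem b B in pB.
have sB : size B = (size B').+1 by rewrite (perm_size pB).
have B'm : size B' <= m by move: Bm; rewrite sB.
have B'E : {subset B' <= dp_boxes E} by move=> b' /mem_rem/BE.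
have BE' b' : b' \in B -> b' = b \/ b' \in B'.
  by rewrite (perm_mem pB) inE => /orP[/eqP|]; [left|right].
have B'B b' : b' \in B' -> b' \in B by exact: mem_rem.
have {}uc : it_cost b + \sum_(b' <- B') it_cost b' + \sum_(l <= t < r) us t <= c.
  by move: uc; rewrite (perm_big _ pB) big_cons.
have drop_b : (forall t, l <= t < r -> e t <= h \/
     exists2 b', b' \in B' & holds b' t && (e t <= it_height b')) ->
  \sum_(l <= t < r) minn (d t) (e t + ws t) <= D j l r h c.
  move=> H; apply: (IH B') => //; first lia.
  by apply: leq_trans uc; rewrite -addnA leq_addl.
case: (leqP (it_height b) h) => hb.
  apply: drop_b => t /eB[|[b' /BE'[->|b'B]]]; first by left.
    by case/andP => _ /leq_trans; left; auto.
  by right; exists b'.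
(* The slots of the interval that [b] alone covers. *)
pose vis t := [&& l <= t < r, holds b t & ~~ has (fun b' => holds b' t) B'].
have visR t : vis t -> t <= r by case/and3P; lia.
case: (boolP [exists t : 'I_r.+1, vis t]) => [/existsP[t0 vt0]|/existsPn novis]; last first.
  apply: drop_b => t tlr; case: (eB t tlr) => [|[b' /BE'[->|b'B] Hb']]; [by left| |].
    case/andP: Hb' => bt eb; right.
    have tr : t < r.+1 by lia.
    have := novis (Ordinal tr); rewrite /vis /= tlr bt /= negbK.
    case/hasP => b2 b2B b2t; exists b2 => //; rewrite b2t (leq_trans eb) //.
    by apply: blow; apply: B'B.
  by right; exists b'.
have exv : exists t, vis t by exists t0.
pose l1 := ex_minn exv; pose r1 := ex_maxn exv visR.
have vl1 : vis l1 by rewrite /l1; case: ex_minnP.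
have vr1 : vis r1 by rewrite /r1; case: ex_maxnP.
have l1min t : vis t -> l1 <= t by rewrite /l1; case: ex_minnP => ? _; apply.
have r1max t : vis t -> t <= r1 by rewrite /r1; case: ex_maxnP => ? _; apply.
have l1r1 := l1min _ vr1.
have notl1 b' : b' \in B' -> ~~ holds b' l1.
  by move=> b'B; case/and3P: vl1 => _ _ /hasPn; apply.
have notr1 b' : b' \in B' -> ~~ holds b' r1.
  by move=> b'B; case/and3P: vr1 => _ _ /hasPn; apply.
have [ll1 l1r] : l <= l1 /\ l1 < r by case/and3P: vl1 => /andP[].
have [lr1 r1r] : l <= r1 /\ r1 < r by case/and3P: vr1 => /andP[].
have [bl1 br1] : it_start b <= l1 /\ r1 <= it_finish b.
  by case/and3P: vl1 => _ /andP[-> _] _; case/and3P: vr1 => _ /andP[].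
have covered_t t : l <= t < r -> ~~ vis t -> e t <= h \/
     exists2 b', b' \in B' & holds b' t && (e t <= it_height b').
  move=> tlr nvt; case: (eB t tlr) => [|[b' /BE'[->|b'B] Hb']]; [by left| |].
    case/andP: Hb' => bt eb; right; move: nvt; rewrite /vis tlr bt /= negbK.
    case/hasP => b2 b2B b2t; exists b2 => //; rewrite b2t (leq_trans eb) //.
    by apply: blow; apply: B'B.
  by right; exists b'.
(* A box ending before [l1] goes to the left part, one starting after [r1] to the right part. Of the
   rest, those that meet the hull lie strictly between [l1] and [r1]. *)
pose P1 (b' : item) := it_finish b' < l1.
pose P3 (b' : item) := r1 < it_start b'.
pose B1 := [seq b' <- B' | P1 b'].
pose B3 := [seq b' <- B' | ~~ P1 b' && P3 b'].
pose B2 := [seq b' <- B' | ~~ P1 b' && ~~ P3 b'].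
have sizeF (P : pred item) : size [seq b' <- B' | P b'] <= m.
  by rewrite size_filter; apply: leq_trans (count_size _ _) B'm.
have subF (P : pred item) : {subset [seq b' <- B' | P b'] <= dp_boxes E}.
  by move=> b'; rewrite mem_filter => /andP[_ /B'E].
have costE : \sum_(b' <- B') it_cost b' = \sum_(b' <- B1) it_cost b' +
    (\sum_(b' <- B3) it_cost b' + \sum_(b' <- B2) it_cost b').
  by rewrite !big_filter (bigID P1) /= (bigID P3 (fun b' => ~~ P1 b')).
have usE : \sum_(l <= t < r) us t = \sum_(l <= t < l1) us t +
    (\sum_(l1 <= t < r1.+1) us t + \sum_(r1.+1 <= t < r) us t).
  rewrite -(big_cat_nat (n := r1.+1)) //=; last exact: leqW.
  by rewrite -big_cat_nat // ltnW.
rewrite (big_cat_nat (n := l1)) //=; last exact: ltnW.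
rewrite (@big_cat_nat _ _ _ r1.+1 l1) //=; last exact: leqW.
case: j jm {drop_b} => [|[|[|j]]] jm; try by move: jm; clear; lia.
move: usE costE uc; set u1 := \sum_(l <= t < l1) us t.
set u2 := \sum_(l1 <= t < r1.+1) us t; set u3 := \sum_(r1.+1 <= t < r) us t.
set q1 := \sum_(b' <- B1) it_cost b'; set q2 := \sum_(b' <- B2) it_cost b'.
set q3 := \sum_(b' <- B3) it_cost b' => -> -> uc.
(* The left part receives exactly its cost, the middle part its cost together with that of [b], and
   the right part whatever remains. *)
have [c1 c1E] : exists c1, c1 = q1 + u1 by eexists.
have [c2 c2E] : exists c2, c2 = it_cost b + (q2 + u2) by eexists.
have [c1c c2c c3c] : [/\ c1 <= c, c2 <= c - c1 & q3 + u3 <= c - c1 - c2].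
  rewrite c1E c2E; move: uc; clear; move: (it_cost b) q1 q2 q3 u1 u2 u3 => *.
  by split; lia.
have q1c : q1 + u1 <= c1 by rewrite c1E.
have bc2 : it_cost b <= c2 by rewrite c2E leq_addr.
have q2c : q2 + u2 <= c2 - it_cost b by rewrite c2E addKn.
clear uc c1E c2E.
have l1T : l1 <= T by apply: leq_trans rT; apply: ltnW.
have r1T : r1.+1 <= T by apply: leq_trans rT.
have c1K : c - c1 < K by apply: leq_ltn_trans cK; apply: leq_subr.
have c2K : c2 < K by apply: leq_ltn_trans c1K.
have c2K' : c2 - it_cost b < K by apply: leq_ltn_trans c2K; apply: leq_subr.
have c3K : c - c1 - c2 < K by apply: leq_ltn_trans c1K; apply: leq_subr.
have c1K' : c1 < K by apply: leq_ltn_trans cK.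
(* The first split leaves [j.+2] rounds on the left, the second [j.+1] on the right, and opening [b]
   leaves [j] in the middle. *)
have sizes : [/\ 3 * m + (l1 - l) <= j.+2, 3 * m + (r1.+1 - l1) <= j
    & 3 * m + (r - r1.+1) <= j.+1].
  by move: jm ll1 l1r1 r1r; clear; move=> *; split; lia.
case: sizes => jm1 jm2 jm3.
apply: leq_trans (@dp_split j.+2 l l1 r h c c1 ll1 (ltnW l1r) rT hh c1c cK).
apply: leq_add.
  apply: (IH B1) => //; [exact: sizeF|exact: subF|].
  move=> t /andP[lt tl1]; have tlr : l <= t < r by rewrite lt (ltn_trans tl1 l1r).
  have nvt : ~~ vis t by apply/negP => /l1min; rewrite leqNgt tl1.
  case: (covered_t t tlr nvt) => [|[b' b'B Hb']]; first by left.
  right; exists b' => //; rewrite mem_filter b'B andbT /P1.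
  have := notl1 b' b'B; case/andP: Hb' => + _; move: tl1; rewrite /holds; clear; lia.
apply: leq_trans (@dp_split j.+1 l1 r1.+1 r h (c - c1) c2 (leqW l1r1) r1r rT hh c2c c1K).
apply: leq_add; last first.
  apply: (IH B3) => //; [exact: sizeF|exact: subF|].
  move=> t /andP[r1t tr]; have tlr : l <= t < r.
    by rewrite tr andbT (leq_trans lr1) // ltnW.
  have nvt : ~~ vis t by apply/negP => /r1max; rewrite leqNgt r1t.
  case: (covered_t t tlr nvt) => [|[b' b'B Hb']]; first by left.
  right; exists b' => //; rewrite mem_filter b'B andbT /P1 /P3.
  have := notr1 b' b'B; case/andP: Hb' => + _; move: r1t l1r1; rewrite /holds; clear; lia.
have bE := BE b bB.
(* Raising the base to the height of [b] keeps the slots below the old base served and serves those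
   assigned to [b]. *)
apply: leq_trans (@dp_box j l1 r1.+1 h c2 b l1T r1T hh c2K bE bl1 _ bc2) => //.
apply: (IH B2) => //; [exact: sizeF|exact: subF|exact: leqW|exact: heightsP|].
move=> t /andP[l1t tr1]; have tlr : l <= t < r.
  by rewrite (leq_trans ll1 l1t) (leq_trans tr1 r1r).
case: (eB t tlr) => [eh|[b' /BE'[->|b'B] Hb']].
- by left; apply: leq_trans eh (ltnW hb).
- by left; case/andP: Hb'.
- right; exists b' => //; rewrite mem_filter b'B andbT /P1 /P3.
  have := notr1 b' b'B; have := notl1 b' b'B; case/andP: Hb' => + _.
  by move: l1t tr1; rewrite /holds; clear; lia.
Qed.

End Completeness.

(** * Soundness of the dynamic program *)

Lemma sumn_iota (F : nat -> nat) n : sumn [seq F i | i <- iota 0 n] = \sum_(i < n) F i.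
Proof. by rewrite sumnE big_map -[n in iota 0 n]subn0 big_mkord. Qed.

Lemma copies_costE p x : copies_cost p x = \sum_(i < size x) nth 0 x i * nth 0 p i.
Proof. exact: sumn_iota. Qed.

Definition rd_active rs i t := rd_start (nth rd0 rs i) <= t <= rd_finish (nth rd0 rs i).

Lemma coveredE rs x t : covered rs x t =
  \sum_(i < size rs | rd_active rs i t) nth 0 x i * rd_cap (nth rd0 rs i).
Proof. by rewrite [RHS]big_mkcond; apply: sumn_iota. Qed.

Lemma nth_raise x j a i : i < size x ->
  nth 0 (raise_copies x j a) i = nth 0 x i + (if i == j then a else 0).
Proof. by move=> ix; rewrite (nth_map 0) ?size_iota // nth_iota. Qed.

Lemma nth_add_copies x y i : i < size x ->
  nth 0 (add_copies x y) i = nth 0 x i + nth 0 y i.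
Proof. by move=> ix; rewrite (nth_map 0) ?size_iota // nth_iota. Qed.

Lemma size_raise x j a : size (raise_copies x j a) = size x.
Proof. by rewrite size_map size_iota. Qed.

Lemma size_add_copies x y : size (add_copies x y) = size x.
Proof. by rewrite size_map size_iota. Qed.

Lemma sum_raise (P : pred nat) (F : nat -> nat) x j a : j < size x ->
  \sum_(i < size x | P i) nth 0 (raise_copies x j a) i * F i =
  \sum_(i < size x | P i) nth 0 x i * F i + (if P j then a * F j else 0).
Proof.
move=> jx.
under eq_bigr => i _ do rewrite nth_raise // mulnDl.
rewrite big_split /=; congr addn; case: ifP => Pj.
  rewrite (bigD1 (Ordinal jx)) //= eqxx big1 ?addn0 // => i /andP[_ ij].
  by rewrite ifN // mul0n.
rewrite big1 // => i Pi; rewrite ifN //; apply: contraFneq Pj => <-; exact: Pi.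
Qed.

Lemma sum_add_copies (P : pred nat) (F : nat -> nat) x y :
  \sum_(i < size x | P i) nth 0 (add_copies x y) i * F i =
  \sum_(i < size x | P i) nth 0 x i * F i + \sum_(i < size x | P i) nth 0 y i * F i.
Proof. by rewrite -big_split /=; apply: eq_bigr => i _; rewrite nth_add_copies // mulnDl. Qed.

Lemma ceil_div_ge a p v : v <= p -> a * v <= ceil_div (a * v) p * p.
Proof.
case: p => [|p]; first by rewrite leqn0 => /eqP ->; rewrite !muln0.
by move=> _; rewrite /ceil_div; have := ltn_ceil (a * v + (p.+1 - 1)) (ltn0Sn p); lia.
Qed.

Section Soundness.
Variables (rs : seq resource_data) (p : seq nat) (A P : nat) (E : dp_data).

Let n := size rs.
Let T := size (dp_demands E).
Let d := nth 0 (dp_demands E).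
Let short i := rd_short (nth rd0 rs i).
Let start i := rd_start (nth rd0 rs i).

(** The interval of a short resource is one slot, so it is active at [t] exactly if it starts
    there. *)
Definition shorts_at (x : seq nat) t :=
  \sum_(i < size rs | rd_short (nth rd0 rs i) && (rd_start (nth rd0 rs i) == t)) nth 0 x i.

Hypothesis short_single : forall i, i < n -> short i ->
  rd_finish (nth rd0 rs i) = start i.
Hypothesis zerosE : dp_zeros E = [seq 0 | _ <- rs].
Hypothesis boxesE : dp_boxes E = scaled A P (boxes (dp_demands E) rs p).
Hypothesis shortsE : dp_shorts E = scaled A P (short_items rs p).

(** The budget is compared with the true cost after scaling by [A] and [P]. That used short
    resources start inside the interval makes adjacent intervals compatible. Coverage is the actual
    sum of capacities, which dominates the maximum used by the program. *)
Definition sound (k : key) (e : entry) :=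
  [/\ size e.2 = n,
      A * copies_cost p e.2 <= k.2.2 * P,
      forall i, i < n -> short i -> 0 < nth 0 e.2 i -> k.1.1 <= start i < k.1.2,
      forall t, shorts_at e.2 t <= 1
    & e.1 <= \sum_(k.1.1 <= t < k.1.2) minn (d t) (k.2.1 + covered rs e.2 t)].

Lemma mem_scaled_boxes b : b \in dp_boxes E ->
  [/\ it_res b < n, ~~ short (it_res b),
      it_start b = start (it_res b), it_finish b = rd_finish (nth rd0 rs (it_res b)) &
      it_height b = it_mult b * rd_cap (nth rd0 rs (it_res b)) /\
      A * (it_mult b * nth 0 p (it_res b)) <= it_cost b * P].
Proof.
rewrite boxesE => /mapP[b0]; rewrite mem_filter => /andP[costP].
case/mapP=> ih /allpairsPdep[i [h [iP _ ->]]] b0E ->.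
move: iP; rewrite mem_filter mem_iota => /andP[is_long /= iN].
rewrite b0E in costP *; split=> //; split=> //.
exact: ceil_div_ge.
Qed.

Lemma mem_scaled_shorts b : b \in dp_shorts E ->
  [/\ it_res b < n, short (it_res b), it_start b = start (it_res b),
      it_height b = rd_cap (nth rd0 rs (it_res b)) &
      A * nth 0 p (it_res b) <= it_cost b * P].
Proof.
rewrite shortsE => /mapP[b0]; rewrite mem_filter => /andP[costP].
case/mapP=> i; rewrite mem_filter mem_iota => /andP[is_short /= iN] b0E ->.
rewrite b0E in costP *; split=> //; first by rewrite /it_height /= mul1n.
rewrite -[nth 0 p _]mul1n; exact: ceil_div_ge.
Qed.

Lemma sound_zeros k g :
  g <= \sum_(k.1.1 <= t < k.1.2) minn (d t) k.2.1 -> sound k (g, dp_zeros E).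
Proof.
have z i : nth 0 [seq 0 | _ <- rs] i = 0.
  by elim: rs i => [|r rs' IH] [|i] //=; apply: IH.
move=> gk; rewrite zerosE; split=> /=.
- by rewrite size_map.
- rewrite copies_costE big1 ?muln0 // => i _; by rewrite z.
- by move=> i _ _; rewrite z.
- by move=> t; rewrite /shorts_at big1 // => i _; rewrite z.
- apply: leq_trans gk _; apply: leq_sum => t _.
  by rewrite coveredE big1 ?addn0 // => i _; rewrite z.
Qed.

Lemma sound_slot_short k b : b \in dp_shorts E -> k.1.2 = k.1.1.+1 ->
  it_start b = k.1.1 -> it_cost b <= k.2.2 ->
  sound k (minn (d k.1.1) (k.2.1 + it_height b), raise_copies (dp_zeros E) (it_res b) 1).
Proof.
move=> /mem_scaled_shorts[bn bs bst bh bc] kE bk bck.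
have [zs zc zl zt _] : sound k (0, dp_zeros E) by apply: sound_zeros.
have z i : nth 0 (dp_zeros E) i = 0.
  by rewrite zerosE; elim: rs i => [|r rs' IH] [|i] //=; apply: IH.
have bz : it_res b < size (dp_zeros E) by rewrite zs.
have nth_r i : i < n ->
    nth 0 (raise_copies (dp_zeros E) (it_res b) 1) i = (if i == it_res b then 1 else 0).
  by move=> ni; rewrite nth_raise ?zs // z.
split=> /=.
- by rewrite size_raise.
- rewrite copies_costE size_raise (sum_raise xpredT) //= big1 => [|i _]; last by rewrite z.
  by rewrite add0n mul1n (leq_trans bc) // leq_mul2r bck orbT.
- move=> i ni _; rewrite nth_r //; case: eqP => // -> _.
  by rewrite -bst bk kE leqnn ltnSn.
- move=> t; rewrite /shorts_at.
  under eq_bigr => i _ do rewrite nth_r //.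
  rewrite -big_mkcondr /= sum1_card.
  apply: (@leq_trans #|pred1 (Ordinal bn)|); last by rewrite card1.
  apply: subset_leq_card; apply/subsetP => i; rewrite !inE => /andP[_ /eqP ib].
  exact/eqP/val_inj.
- rewrite kE big_nat1 leq_min geq_minl (leq_trans (geq_minr _ _)) // leq_add2l.
  rewrite coveredE -/n -zs (sum_raise (fun i => rd_active rs i k.1.1)
    (fun i => rd_cap (nth rd0 rs i))) //=.
  by rewrite /rd_active short_single // -/(start _) -bst bk leqnn mul1n bh leq_addl.
Qed.

(** The copies of the box supply its height on the whole interval, so they pay for the raised base;
    being long, they leave the condition on short resources alone. *)
Lemma sound_box k b e : b \in dp_boxes E ->
  it_start b <= k.1.1 -> k.1.2 <= (it_finish b).+1 -> it_cost b <= k.2.2 ->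
  sound (k.1, (it_height b, k.2.2 - it_cost b)) e ->
  sound k (e.1, raise_copies e.2 (it_res b) (it_mult b)).
Proof.
move=> /mem_scaled_boxes[bn bl bst bf [bh bc]] bk1 bk2 bck [es ec el et eg].
have be : it_res b < size e.2 by rewrite es.
split=> /=.
- by rewrite size_raise.
- rewrite copies_costE size_raise (sum_raise xpredT) //= -copies_costE mulnDr.
  rewrite -(subnK bck) mulnDl leq_add //.
- move=> i ni si; rewrite nth_raise ?es //; case: eqP => [ib|_].
    by rewrite -ib si in bl.
  by rewrite addn0; apply: el.
- move=> t; apply: leq_trans (et t); rewrite /shorts_at.
  apply: eq_leq; apply: eq_bigr => i /andP[si _]; rewrite nth_raise ?es //.
  by case: eqP => [ib|_]; [rewrite /short -ib si in bl | rewrite addn0].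
- apply: leq_trans eg _; rewrite /= big_nat_cond [leqRHS]big_nat_cond.
  apply: leq_sum => t; rewrite andbT => /andP[kt tk].
  rewrite leq_min geq_minl (leq_trans (geq_minr _ _)) //.
  rewrite 2!coveredE -/n -es (sum_raise (fun i => rd_active rs i t)
    (fun i => rd_cap (nth rd0 rs i))) //= ifT; first by rewrite bh; lia.
  by rewrite /rd_active -/(start _) -bst -bf (leq_trans bk1 kt) -ltnS (leq_trans tk bk2).
Qed.

(** Each slot lies on one side of [m], and only the solution of that side can use a short resource
    there. Adding the other copies never lowers coverage. *)
Lemma sound_split k m c e1 e2 : k.1.1 <= m <= k.1.2 -> c <= k.2.2 ->
  sound ((k.1.1, m), (k.2.1, c)) e1 -> sound ((m, k.1.2), (k.2.1, k.2.2 - c)) e2 ->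
  sound k (e1.1 + e2.1, add_copies e1.2 e2.2).
Proof.
move=> /andP[km mk] ck [es1 ec1 el1 et1 eg1] [es2 ec2 el2 et2 eg2].
have nthE i : i < n -> nth 0 (add_copies e1.2 e2.2) i = nth 0 e1.2 i + nth 0 e2.2 i.
  by move=> ni; rewrite nth_add_copies ?es1.
have covE t : covered rs (add_copies e1.2 e2.2) t = covered rs e1.2 t + covered rs e2.2 t.
  rewrite !coveredE -/n -es1; exact: (sum_add_copies (fun i => rd_active rs i t)
    (fun i => rd_cap (nth rd0 rs i))).
split=> /=.
- by rewrite size_add_copies.
- rewrite copies_costE size_add_copies (sum_add_copies xpredT) /= -copies_costE.
  rewrite es1 -es2 -copies_costE mulnDr -(subnKC ck) mulnDl leq_add //.
- move=> i ni si; rewrite nthE // addn_gt0 => /orP[/(el1 i ni si)|/(el2 i ni si)] /=; lia.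
- move=> t.
  have addE : shorts_at (add_copies e1.2 e2.2) t = shorts_at e1.2 t + shorts_at e2.2 t.
    by rewrite /shorts_at -big_split /=; apply: eq_bigr => i _; rewrite nthE.
  rewrite addE; case: (ltnP t m) => tm.
    rewrite [shorts_at e2.2 t]big1 ?addn0 // => i /andP[si /eqP it].
    apply/eqP; rewrite -leqn0 leqNgt; apply/negP => /(el2 i (ltn_ord i) si) /=.
    by rewrite /start it leqNgt tm.
  rewrite [shorts_at e1.2 t]big1 ?add0n // => i /andP[si /eqP it].
  apply/eqP; rewrite -leqn0 leqNgt; apply/negP => /(el1 i (ltn_ord i) si) /=.
  by rewrite /start it ltnNge tm andbF.
- rewrite (big_cat_nat (n := m)) //= leq_add //.
    apply: leq_trans eg1 _; apply: leq_sum => t _.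
    by rewrite leq_min geq_minl (leq_trans (geq_minr _ _)) // covE /=; lia.
  apply: leq_trans eg2 _; apply: leq_sum => t _.
  by rewrite leq_min geq_minl (leq_trans (geq_minr _ _)) // covE /=; lia.
Qed.

Lemma sound_dp_entry tb k :
  (forall ke, ke \in tb -> sound ke.1 ke.2) -> sound k (dp_entry E tb k).
Proof.
move=> tbS.
have getS k' : sound k' (dp_get E tb k').
  rewrite /dp_get; case: (lookup_mem tb k' (0, dp_zeros E)) => [->|[ke ketb [-> kk]]].
    exact: sound_zeros.
  by rewrite (key_eq_eq kk); apply: tbS.
have := foldl_select_mem (fun acc e' : entry => acc.1 <= e'.1) (dp_get E tb k)
  (slot_entries E k ++ (box_entries E tb k ++ split_entries E tb k)).
rewrite -/(best_entry _ _) -/(dp_entry E tb k) inE !mem_cat => /orP[/eqP ->|].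
  exact: getS.
case/orP => [|/orP[]].
- rewrite /slot_entries; case: eqP => // kE; rewrite inE => /orP[/eqP ->|].
    by apply: sound_zeros; rewrite kE big_nat1.
  case/mapP => b; rewrite mem_filter => /andP[/andP[/eqP bk bc] bE] ->.
  exact: sound_slot_short.
- by case/mapP => b; rewrite mem_filter => /andP[/and3P[b1 b2 b3] bE] ->; apply: sound_box.
- case/mapP => mc; rewrite mem_filter => /andP[/and3P[m1 m2 m3] _] ->.
  by apply: sound_split (getS _) (getS _) => //; apply/andP; split.
Qed.

Lemma sound_dp_get j k : sound k (dp_get E (iter j (dp_step E) [::]) k).
Proof.
have tbS ke : ke \in iter j (dp_step E) [::] -> sound ke.1 ke.2.
  elim: j ke => //= j IH ke /mapP[k' _ ->]; exact: sound_dp_entry.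
rewrite /dp_get; case: (lookup_mem (iter j (dp_step E) [::]) k (0, dp_zeros E)).
  by move=> ->; apply: sound_zeros.
by case=> ke ketb [-> /key_eq_eq ->]; apply: tbS.
Qed.

End Soundness.

(** * Replacing sums of long resources by maxima of boxes *)

Section Peeling.
Variables (I : finType) (s f : I -> nat).

Definition meets (i : I) (t : nat) := s i <= t <= f i.

(* Of three intervals meeting at [t], one is contained in the union of the one
   starting first and the one ending last. *)
Lemma shallow_subcover (A : {set I}) : exists2 M : {set I}, M \subset A &
  (forall t i, i \in A -> meets i t -> exists2 j, j \in M & meets j t) /\
  (forall t, #|[set i in M | meets i t]| <= 2).
Proof.
have [m] := ubnP #|A|; elim: m A => // m IH A; rewrite ltnS => Am.
have redundant c : c \in A ->
    (forall t, meets c t -> exists2 j, j \in A :\ c & meets j t) ->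
    exists2 M : {set I}, M \subset A &
      (forall t i, i \in A -> meets i t -> exists2 j, j \in M & meets j t) /\
      (forall t, #|[set i in M | meets i t]| <= 2).
  move=> cA Hc; have [|M MA [Mc Md]] := IH (A :\ c).
    by rewrite (leq_trans _ Am) // (cardsD1 c A) cA.
  exists M; first by apply: subset_trans MA (subsetDl _ _).
  split=> // t i iA it; case: (eqVneq i c) => [ic|ic]; last first.
    by apply: Mc it; rewrite !inE ic.
  by rewrite ic in it; have [j jA jt] := Hc t it; apply: Mc jt.
(* A redundant interval is removed by induction; otherwise [A] itself works. No interval meets a
   slot beyond the largest endpoint, so finitely many slots decide redundancy. *)
case: (boolP [exists c in A, [forall t : 'I_(\max_i f i).+1,
    meets c t ==> [exists j in A :\ c, meets j t]]]) => [|/existsPn nored].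
  case/exists_inP => c cA /forallP Hc; apply: (redundant c cA) => t ct.
  have tm : t < (\max_i f i).+1.
    by rewrite ltnS; case/andP: ct => _ /leq_trans; apply; apply: leq_bigmax.
  by have /implyP/(_ ct)/exists_inP := Hc (Ordinal tm).
exists A => //; split; first by move=> t i iA it; exists i.
move=> t; rewrite leqNgt; apply/negP => D2.
set D := [set i in A | meets i t] in D2.
have [a0 a0D] : exists a0, a0 \in D by apply/set0Pn; rewrite -card_gt0; lia.
have [a aD amin] := @arg_minnP I a0 (mem D) s a0D.
have [b bD bmax] := @arg_maxnP I a0 (mem D) f a0D.
have [c] : exists c, c \in D :\ a :\ b.
  apply/set0Pn; rewrite -card_gt0.
  have := cardsD1 a D; have := cardsD1 b (D :\ a).
  by case: (a \in D); case: (b \in D :\ a); lia.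
rewrite !inE => /and3P[cb ca /andP[cA ct]].
have /andP[aA at_] : (a \in A) && meets a t by move: aD; rewrite /= !inE.
have /andP[bA bt] : (b \in A) && meets b t by move: bD; rewrite /= !inE.
have cD : c \in D by rewrite inE cA.
have sac : s a <= s c := amin c cD.
have fcb : f c <= f b := bmax c cD.
have := nored c; rewrite cA /= => /forallP; apply => t'; apply/implyP => ct'.
apply/exists_inP; rewrite /meets in ct at_ bt ct' *.
(* Up to [t] the interval of [c] lies within that of [a], after [t] within that of [b]. *)
case: (leqP t' t) => tt'.
  by exists a; [rewrite !inE eq_sym ca | lia].
by exists b; [rewrite !inE eq_sym cb | lia].
Qed.

(** Each layer is a shallow subcover of the remaining support and lowers every load by at most 2; so
    a slot of load above [2 * r] is still positive after [r] layers. *)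
Lemma exists_layers n (y : I -> nat) : exists M : nat -> {set I},
  (forall i, \sum_(r < n) (i \in M r) <= y i) /\
  (forall r t, r < n -> 2 * r < \sum_(i | meets i t) y i ->
     exists2 i, i \in M r & meets i t).
Proof.
elim: n y => [|n IH] y.
  by exists (fun=> set0); split=> // i; rewrite big_ord0.
have [M0 M0y [M0c M0d]] := shallow_subcover [set i | 0 < y i].
have M0y' i : (i \in M0) <= y i.
  by case: (boolP (i \in M0)) => // /(subsetP M0y); rewrite inE.
have [M [Ms Mc]] := IH (fun i => y i - (i \in M0)).
exists (fun r => if r is r'.+1 then M r' else M0); split.
  by move=> i; rewrite big_ord_recl /= -leq_subRL.
move=> [|r] t.
  move=> _; rewrite muln0 lt0n sum_nat_eq0 => /forallPn[i].
  rewrite negb_imply -lt0n => /andP[it yi].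
  by apply: (M0c t i) => //; rewrite inE.
rewrite ltnS => rn yt; apply: Mc => //.
have : \sum_(i | meets i t) y i =
    \sum_(i | meets i t) (y i - (i \in M0)) + \sum_(i | meets i t) (i \in M0).
  by rewrite -big_split /=; apply: eq_bigr => i _ /=; rewrite subnK.
have : \sum_(i | meets i t) (i \in M0) <= 2.
  apply: leq_trans (M0d t); rewrite -sum1_card [X in _ <= X]big_mkcond /= big_mkcond /=.
  by apply: leq_sum => i _; rewrite inE; case: (meets i t); case: (i \in M0).
lia.
Qed.

End Peeling.

(** * Choosing a cheap layer for each power of two *)

Section Levels.
Local Open Scope ring_scope.

Lemma exists_le_average (F : nat -> rat) (a m : nat) : (0 < m)%N ->
  exists2 j, (j < m)%N & m%:R * F (a + j)%N <= \sum_(j < m) F (a + j)%N.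
Proof.
case: m => // m _; elim: m => [|m [j jm Hj]].
  by exists 0%N => //; rewrite big_ord1 mul1r.
rewrite big_ord_recr /=; case: (lerP (F (a + j)%N) (F (a + m.+1)%N)) => Fj.
  exists j; first exact: ltnW.
  by rewrite -[m.+2%:R]natr1 mulrDl mul1r lerD.
exists m.+1 => //; rewrite -[m.+2%:R]natr1 mulrDl mul1r lerD2r.
by apply: le_trans Hj; rewrite ler_wpM2l ?ler0n // ltW.
Qed.

(** The number of layers reserved for the levels below [l]: layers 0 and 1 belong to levels 0 and 1,
    and the [2 ^ l] layers from [(2 ^ l).+1] to [2 ^ l.+1] to level [l.+2]. *)
Definition layer_count (l : nat) : nat := if l is l'.+2 then (2 ^ l').+1 else l.

(* Level [l] uses a layer of index at most [2 ^ l / 2] among [2 ^ l / 4] layers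
   not used by other levels. *)
Lemma exists_cheap_layers (F : nat -> rat) : (forall r, 0 <= F r) ->
  exists2 rho : nat -> nat, (forall l, (2 * rho l <= 2 ^ l)%N) &
    forall n, \sum_(l < n) (2 ^ l.+1)%:R * F (rho l) <=
              8 * \sum_(r < layer_count n) F r.
Proof.
move=> F0.
pose P l r := (2 * r <= 2 ^ l)%N && ((2 ^ l.+1)%:R * F r <=
  8 * \sum_(layer_count l <= r' < layer_count l.+1) F r').
have exP l : exists r, P l r.
  case: l => [|[|l]].
  - exists 0%N; rewrite /P /= big_nat1; have := F0 0%N.
    by move: (F _) => u hu; apply: ler_pM => //; rewrite ler_nat.
  - exists 1%N; rewrite /P /= big_nat1; have := F0 1%N.
    by move: (F _) => u hu; apply: ler_pM => //; rewrite ler_nat.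
  (* The cheapest of the [2 ^ l] layers costs at most their average; the height [2 ^ l.+3] is 8
     times their number. *)
  - have [j jl Hj] := exists_le_average F (2 ^ l).+1 (expn_gt0 2 l).
    exists ((2 ^ l).+1 + j)%N; apply/andP; split; first by rewrite !expnS; lia.
    rewrite /layer_count.
    have -> : \sum_((2 ^ l).+1 <= r' < (2 ^ l.+1).+1) F r' =
        \sum_(j < 2 ^ l) F ((2 ^ l).+1 + j)%N.
      rewrite -{1}(add0n (2 ^ l).+1) big_addn.
      have -> : ((2 ^ l.+1).+1 - (2 ^ l).+1 = 2 ^ l)%N by rewrite expnS; lia.
      by rewrite big_mkord; apply: eq_bigr => j' _; rewrite addnC.
    have -> : (2 ^ l.+3)%:R = 8 * (2 ^ l)%:R :> rat.
      by rewrite -[8]/(8%:R) -natrM !expnS; congr (_%:R); lia.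
    by rewrite -mulrA ler_pM2l.
exists (fun l => xchoose (exP l)); first by move=> l; case/andP: (xchooseP (exP l)).
elim=> [|n IH]; first by rewrite !big_ord0 mulr0.
rewrite big_ord_recr /= -(big_mkord xpredT) (big_cat_nat (n := layer_count n)) //=.
  rewrite mulrDr big_mkord lerD //; by case/andP: (xchooseP (exP n)).
by case: n {IH} => [|[|n]] //=; rewrite ltnS leq_exp2l.
Qed.

End Levels.

(** * From layers to boxes *)

Section Boxes.
Variables (I : finType) (s f : I -> nat) (w p x : I -> nat).

Let load t := \sum_(i | meets s f i t) x i * w i.

Local Open Scope ring_scope.

(** Resource [i] is split into [x i * w i] pieces of price [p i / w i]. The layers use each piece at
    most once, so the selected ones, weighted by height, cost at most 8 times the original price. *)
Lemma exists_levels n : exists N : nat -> {set I},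
  [/\ forall l i, (l < n)%N -> i \in N l -> (0 < x i)%N && (0 < w i)%N,
      forall l t, (l < n)%N -> (if l == 0 then 0 < load t else 2 ^ l < load t)%N ->
        exists2 i, i \in N l & meets s f i t
    & \sum_(l < n) (2 ^ l.+1)%:R * (\sum_(i in N l) (p i)%:R / (w i)%:R) <=
      8 * \sum_i (p i * x i)%:R :> rat].
Proof.
(* Enough layers for every index [rho l] with [l < n] and for the first [layer_count n] layers in
   the cost bound. *)
have [M [Ms Mc]] := exists_layers s f (2 ^ n + layer_count n) (fun i => x i * w i)%N.
pose q i : rat := (p i)%:R / (w i)%:R.
have q0 i : 0 <= q i by rewrite divr_ge0.
pose F r := \sum_(i in M r) q i.
have [rho rho2 rhoS] : exists2 rho : nat -> nat, (forall l, (2 * rho l <= 2 ^ l)%N) &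
    forall n, \sum_(l < n) (2 ^ l.+1)%:R * F (rho l) <= 8 * \sum_(r < layer_count n) F r.
  by apply: exists_cheap_layers => r; apply: sumr_ge0.
have rho_lt l : (l < n)%N -> (rho l < 2 ^ n + layer_count n)%N.
  move=> ln; have : (2 ^ l < 2 ^ n)%N by rewrite ltn_exp2l.
  by have := rho2 l; lia.
exists (fun l => M (rho l)); split.
- move=> l i /rho_lt ln il; rewrite -muln_gt0; apply: leq_trans (Ms i).
  by rewrite (bigD1 (Ordinal ln)) //= il.
- move=> l t /rho_lt ln Hl; apply: Mc => //.
  case: l Hl {ln} => [|l] /= Hl; last by apply: leq_ltn_trans (rho2 _) _.
  (* Level 0 must also serve load 1; this works because [2 * rho 0 <= 1] forces [rho 0 = 0]. *)
  by have := rho2 0; rewrite expn0; case: (rho 0) => [|r] //; lia.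
- apply: le_trans (rhoS n) _; rewrite ler_pM2l //.
  under eq_bigr do rewrite /F big_mkcond /=.
  rewrite exchange_big /=; apply: ler_sum => i _.
  have -> : \sum_(r < layer_count n) (if i \in M r then q i else 0) =
      (\sum_(r < layer_count n) (i \in M r))%:R * q i.
    rewrite natr_sum mulr_suml; apply: eq_bigr => r _.
    by case: (i \in M r); rewrite ?mul1r ?mul0r.
  have : (\sum_(r < layer_count n) (i \in M r) <= x i * w i)%N.
    apply: leq_trans (Ms i); rewrite addnC big_split_ord /=; exact: leq_addr.
  rewrite -(ler_nat rat) => /(ler_wpM2r (q0 i))/le_trans; apply.
  (* For capacity 0 both sides make sense, as division by 0 gives 0. *)
  rewrite /q; case: (w i) => [|w']; first by rewrite muln0 mul0r.
  rewrite !natrM [leLHS](_ : _ = (p i)%:R * (x i)%:R) //.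
  by rewrite mulrC -mulrA (mulrC (x i)%:R) mulKf ?pnatr_eq0.
Qed.

(** Rounding up to whole copies costs a factor 3 / 2 if the height exceeds twice the capacity.
    Otherwise two copies reach the height, and the same two copies serve all such levels. In total
    this gives [8 * 3 / 2 + 2 = 14]. *)
Lemma exists_box_family n : exists chosen : I -> nat -> bool,
  [/\ forall i h, chosen i h -> (0 < x i)%N,
      forall t g, (0 < g <= load t)%N -> (g < 2 ^ n)%N ->
        exists i h, [/\ chosen i h, h \in 0%N :: [seq (2 ^ j.+1)%N | j <- iota 0 n],
                        meets s f i t & (g <= box_mult (w i) h * w i)%N]
    & (\sum_i (chosen i 0%N * (2 * p i) +
        \sum_(l < n) chosen i (2 ^ l.+1)%N * (box_mult (w i) (2 ^ l.+1) * p i)) <=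
       14 * \sum_i p i * x i)%N].
Proof.
have [N [Npos Ncov Ncost]] := exists_levels n.
(* Code 0 is chosen if some level picks [i] with a height of at most [2 * w i]; higher levels are
   chosen individually. *)
pose chosen i h := if h == 0%N
  then [exists l : 'I_n, (i \in N l) && (2 ^ l.+1 <= 2 * w i)%N]
  else [exists l : 'I_n, [&& h == (2 ^ l.+1)%N, i \in N l & (2 * w i < h)%N]].
have chosenE i (l : 'I_n) :
    chosen i (2 ^ l.+1)%N = (i \in N l) && (2 * w i < 2 ^ l.+1)%N.
  rewrite /chosen expn_eq0 /=; apply/existsP/idP => [[l' /and3P[]]|il]; last first.
    by exists l; rewrite eqxx.
  rewrite eqn_exp2l // eqSS => /eqP ll'; have {ll'} <- : l = l' by apply: val_inj.
  by move=> -> ->.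
exists chosen; split.
- move=> i h; rewrite /chosen; case: ifP => _ /existsP[l].
    by case/andP=> /(Npos l i (ltn_ord l))/andP[].
  by case/and3P=> _ /(Npos l i (ltn_ord l))/andP[].
- move=> t g /andP[g0 gt] gn.
  (* The level with [2 ^ l < g <= 2 ^ l.+1], or level 0 for [g = 1]. *)
  have [l ln [gl Hl]] : exists2 l, (l < n)%N &
      (g <= 2 ^ l.+1)%N /\ (if l == 0 then 0 < load t else 2 ^ l < load t)%N.
    elim: (n) gn => [|m IH] gm; first by move: gm; rewrite expn0; lia.
    case: (ltngtP g (2 ^ m)%N) => Hg.
    + by have [l lm Hl] := IH Hg; exists l => //; apply: ltnW.
    + exists m => //; split; first exact: ltnW.
      case: ifP => _; first exact: leq_trans gt.
      exact: leq_trans gt.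
    + case: m {IH} gm Hg => [|m] gm Hg.
        by exists 0%N => //; split; [rewrite Hg | apply: leq_trans gt].
      exists m => //; split; first by rewrite Hg.
      case: ifP => _; first exact: leq_trans gt.
      by apply: leq_trans gt; rewrite Hg ltn_exp2l.
  have [i iN it] := Ncov l t ln Hl; have /andP[_ w0] := Npos l i ln iN.
  case: (leqP (2 ^ l.+1) (2 * w i)) => Hw.
    exists i, 0%N; split=> //; last exact: leq_trans Hw.
    by rewrite /chosen eqxx; apply/existsP; exists (Ordinal ln); rewrite iN.
  exists i, (2 ^ l.+1)%N; split=> //.
  + by rewrite (chosenE i (Ordinal ln)) iN.
  + by rewrite inE; apply/orP; right; apply/mapP; exists l; rewrite ?mem_iota.
  + apply: leq_trans gl _; rewrite /box_mult expn_eq0 /= /ceil_div.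
    have := ltn_ceil (2 ^ l.+1 + (w i - 1)) w0; lia.
- have px i (l : 'I_n) : i \in N l -> (p i <= p i * x i)%N.
    by move=> /(Npos l i (ltn_ord l))/andP[x0 _]; rewrite leq_pmulr.
  (* The 2 pays for the pairs of copies, the 12 for the boxes of positive code. *)
  rewrite big_split /= (_ : 14 = 2 + 12)%N // mulnDl leq_add //.
    rewrite big_distrr /=; apply: leq_sum => i _; rewrite /chosen eqxx.
    by case: existsP => // -[l /andP[/px]]; lia.
  rewrite exchange_big /= -(ler_nat rat).
  apply: (@le_trans _ _ (\sum_(l < n) (3 / 2) *
      ((2 ^ l.+1)%:R * \sum_(i in N l) (p i)%:R / (w i)%:R))); last first.
    rewrite -mulr_sumr natrM natr_sum; have := Ncost.
    by set a := \sum_(l < n) _; set b := \sum_i _ => Hab; lra.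
  rewrite natr_sum; apply: ler_sum => l _.
  rewrite mulr_sumr mulr_sumr natr_sum [leRHS]big_mkcond /=; apply: ler_sum => i _.
  rewrite chosenE; case: (boolP (i \in N l)) => [iN|]; last by rewrite mul0n.
  have /andP[_ w0] := Npos l i (ltn_ord l) iN.
  case: (ltnP (2 * w i) (2 ^ l.+1)) => Hw /=; last first.
    by rewrite mul0n !mulr_ge0 ?invr_ge0 ?ler0n.
  rewrite mul1n /box_mult expn_eq0 /=.
  have w0' : 0 < (w i)%:R :> rat by rewrite ltr0n.
  (* Rounding up adds less than [w i], which is below half the height. *)
  have : (2 * (ceil_div (2 ^ l.+1) (w i) * w i) <= 3 * 2 ^ l.+1)%N.
    by rewrite /ceil_div; have := leq_divM (2 ^ l.+1 + (w i - 1)) (w i); lia.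
  rewrite -(ler_nat rat) !natrM => H.
  rewrite [leRHS](_ : _ = ((3 * (2 ^ l.+1)%:R) / (2 * (w i)%:R)) * (p i)%:R); last first.
    by field; rewrite gt_eqF.
  by rewrite ler_wpM2r // ler_pdivlMr ?mulr_gt0 //; lra.
Qed.

End Boxes.

(** * The approximation guarantee *)

Lemma cheapest_spec p z xs x0 : x0 \in xs ->
  cheapest p z xs \in xs /\ copies_cost p (cheapest p z xs) <= copies_cost p x0.
Proof.
case: xs => // x xs x0P; rewrite /cheapest; split; first exact: foldl_select_mem.
elim: xs x x0P => [|y xs IH] x /=; first by rewrite inE => /eqP ->.
have foldl_le xs' x' : copies_cost p (foldl (fun acc y =>
    if copies_cost p y <= copies_cost p acc then y else acc) x' xs') <= copies_cost p x'.
  elim: xs' x' => //= y' xs' IH' x'; case: ifP => // yx.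
  by apply: leq_trans yx; apply: IH'.
rewrite !inE => /or3P[/eqP ->|/eqP ->|x0xs].
- by case: ifP => [/(leq_trans (foldl_le _ _))|_] //; apply: foldl_le.
- apply: leq_trans (foldl_le _ _) _; case: ifP => // /negbT; rewrite -ltnNge; exact: ltnW.
- by apply: IH; rewrite inE x0xs orbT.
Qed.

Lemma budgetsE nl : budgets nl = iota 0 (8 * (size nl * size nl)).+1.
Proof.
rewrite /budgets; congr iota; rewrite -[size (_ :: _)]/(size _).+1; congr _.+1.
by rewrite size_allpairs size_allpairs.
Qed.

Lemma size_item_bound d bx : size (item_bound d bx) = (size bx + size d).+1.
Proof. by rewrite /= size_cat !size_map. Qed.

Lemma dp_table_iter E : dp_table E = iter (size (dp_budgets E)) (dp_step E) [::].
Proof.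
rewrite /dp_table; elim/last_ind: (dp_budgets E) => // l c IH.
by rewrite foldl_rcons IH size_rcons.
Qed.

Lemma all_keysP d bx bl l r h c : l <= size d -> r <= size d ->
  h \in 0 :: [seq it_height b | b <- bx] -> c \in bl ->
  ((l, r), (h, c)) \in all_keys d bx bl.
Proof.
move=> lT rT hh cb; apply/allpairsPdep; exists (l, r), (h, c); split=> //.
  by apply/allpairsPdep; exists l, r; split=> //; rewrite mem_iota.
by apply/allpairsPdep; exists h, c.
Qed.

Lemma foldr_maxn_mem l : foldr maxn 0 l \in 0 :: l.
Proof.
elim: l => //= a l; rewrite !inE => /orP[/eqP ->|Hl]; first by rewrite maxn0 eqxx orbT.
by case: (leqP a (foldr maxn 0 l)); rewrite ?Hl ?eqxx !orbT.
Qed.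

Lemma foldr_maxn_ge l a : a \in l -> a <= foldr maxn 0 l.
Proof.
elim: l => //= b l IH; rewrite inE leq_max => /orP[/eqP -> |/IH ->]; rewrite ?leqnn ?orbT //.
Qed.

Lemma foldr_maxn_le_sumn l : foldr maxn 0 l <= sumn l.
Proof. by elim: l => //= a l IH; rewrite geq_max leq_addr (leq_trans IH) ?leq_addl. Qed.

Lemma ceil_div_le a p v : v <= p -> ceil_div (a * v) p <= a.
Proof.
case: p => [|p]; first by rewrite /ceil_div divn0.
move=> vp; rewrite /ceil_div -ltnS ltn_divLR //.
have : a * v <= a * p.+1 by rewrite leq_mul2l vp orbT.
by rewrite mulSn; lia.
Qed.

Lemma ceil_div_mul_le a p v : ceil_div (a * v) p * p <= a * v + p.
Proof. by rewrite /ceil_div; apply: leq_trans (leq_divM _ _) _; lia. Qed.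

(** * Comparison of the output with an arbitrary feasible solution [xo], [ko] of cost [opt] *)

Section Approximation.
Variables (d : seq nat) (rs : seq resource_data) (p : seq nat) (k : nat).

Let n := size rs.
Let T := size d.
Let r i := nth rd0 rs i.

Hypothesis short_single : forall i, i < n -> rd_short (r i) ->
  rd_finish (r i) = rd_start (r i).

Variables (xo : 'I_n -> nat) (ko : nat -> nat).
Hypothesis ko_demand : forall t, ko t <= nth 0 d t.
Hypothesis ko_target : k <= \sum_(0 <= t < T) ko t.
Hypothesis ko_covered : forall t,
  ko t <= \sum_(i < n | rd_active rs i t) xo i * rd_cap (r i).
Hypothesis xo_short : forall t,
  \sum_(i < n | rd_short (r i) && (rd_start (r i) == t)) xo i <= 1.

Let opt := \sum_(i < n) xo i * nth 0 p i.
Let xl (i : 'I_n) := if rd_short (r i) then 0 else xo i.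
Let st (i : 'I_n) := rd_start (r i).
Let fi (i : 'I_n) := rd_finish (r i).
Let w (i : 'I_n) := rd_cap (r i).
Let load t := \sum_(i | meets st fi i t) xl i * w i.
Let N := size (item_bound d (boxes d rs p)).

Definition short_at t : option 'I_n :=
  [pick i : 'I_n | rd_short (r i) && (rd_start (r i) == t) && (0 < xo i)].

Let ws t := if short_at t is Some i then w i else 0.
Let ps t := if short_at t is Some i then nth 0 p i else 0.

(** At most one copy is allowed per slot, so the picked resource has exactly one copy and all other
    short ones at [t] have none. *)
Lemma short_load_le t :
  \sum_(i < n | rd_short (r i) && rd_active rs i t) xo i * w i <= ws t.
Proof.
have condE (i : 'I_n) : rd_short (r i) && rd_active rs i t =
    rd_short (r i) && (rd_start (r i) == t).
  case: (boolP (rd_short (r i))) => //= si.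
  by rewrite /rd_active -/(r i) short_single // -eqn_leq.
rewrite (eq_bigl _ _ condE) /ws /short_at; case: pickP => [i0 /andP[si0 x0]|none].
  have xi : xo i0 +
      \sum_(i < n | (rd_short (r i) && (rd_start (r i) == t)) && (i != i0)) xo i <= 1.
    by have := xo_short t; rewrite (bigD1 i0).
  have x1 : xo i0 = 1 by lia.
  rewrite (bigD1 i0) //= big1 => [|i ii0]; first by rewrite addn0 x1 mul1n.
  move: xi; rewrite x1 -[leqRHS]addn0 leq_add2l leqn0 sum_nat_eq0.
  by move=> /forall_inP/(_ i ii0)/eqP ->.
rewrite big1 // => i si; have := none i; rewrite si /= lt0n => /negbFE/eqP ->.
by rewrite mul0n.
Qed.

Lemma sum_ps_le : \sum_(0 <= t < T) ps t <=
  \sum_(i < n | rd_short (r i)) xo i * nth 0 p i.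
Proof.
apply: (@leq_trans (\sum_(t < T) \sum_(i < n | rd_short (r i) && (rd_start (r i) == t))
    xo i * nth 0 p i)).
  rewrite big_mkord; apply: leq_sum => t _; rewrite /ps /short_at.
  case: pickP => // i0 /andP[si0 x0]; rewrite (bigD1 i0) //=.
  by apply: leq_trans (leq_addr _ _); rewrite leq_pmull.
under eq_bigr do rewrite big_mkcondr.
rewrite exchange_big /=; apply: leq_sum => i si; rewrite -big_mkcond /=.
case: (ltnP (rd_start (r i)) T) => sT.
  rewrite (bigD1 (Ordinal sT)) //= big1 ?addn0 // => t /andP[/eqP tE].
  by case/eqP; apply: val_inj; rewrite /= tE.
rewrite big1 // => t /eqP tE.
by have := ltn_ord t; rewrite -tE ltnNge sT.
Qed.

(** The long load is cut off at the demand, so that the heights in [pow2s (sumn d)] suffice even for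
    exponentially many copies. *)
Lemma ko_le t : ko t <= minn (nth 0 d t) (minn (nth 0 d t) (load t) + ws t).
Proof.
have : ko t <= load t + ws t.
  apply: leq_trans (ko_covered t) _; rewrite (bigID (fun i : 'I_n => rd_short (r i))) /= addnC.
  apply: leq_add.
    rewrite /load [leqRHS]big_mkcond [leqLHS]big_mkcond; apply: leq_sum => i _ /=.
    rewrite /meets /xl /rd_active -/(r i) -/(st i) -/(fi i).
    by case: (st i <= t <= fi i); case: (rd_short (r i)).
  apply: leq_trans (short_load_le t); apply: eq_leq; apply: eq_bigl => i.
  by rewrite andbC.
by have := ko_demand t; lia.
Qed.

Lemma exists_boxes : exists B : seq item,
  [/\ {subset B <= boxes d rs p}, size B <= size (boxes d rs p),
      \sum_(b <- B) it_cost b <=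
        14 * \sum_(i < n | ~~ rd_short (r i)) xo i * nth 0 p i
    & forall t, minn (nth 0 d t) (load t) <= 0 \/
        exists2 b, b \in B & holds b t && (minn (nth 0 d t) (load t) <= it_height b)].
Proof.
have [chosen [chosen_pos chosen_cov chosen_cost]] :=
  exists_box_family st fi w (fun i => nth 0 p i) xl (halvings (sumn d)).
(* Box codes carry plain numbers; [insub] transfers the choice to them. *)
pose ch (ih : nat * nat) := if insub ih.1 is Some i then chosen i ih.2 else false.
have chE (i : 'I_n) h : ch (nat_of_ord i, h) = chosen i h.
  by rewrite /ch /= valK.
pose mk (ih : nat * nat) :=
  make_item rs p ih.1 (box_mult (rd_cap (nth rd0 rs ih.1)) ih.2).
have boxesE : boxes d rs p = [seq mk ih | ih <- box_codes d rs] by [].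
exists [seq mk ih | ih <- box_codes d rs & ch ih]; split.
- by move=> b /mapP[ih]; rewrite mem_filter => /andP[_ ihP] ->; apply: map_f.
- by rewrite boxesE !size_map size_filter count_size.
- rewrite big_map big_filter /= big_mkcond /= big_allpairs_dep /= big_filter.
  rewrite -[X in iota 0 X]subn0 big_mkord.
  apply: leq_trans (leq_trans _ chosen_cost) _; last first.
    rewrite leq_mul2l /= [leqRHS]big_mkcond /=; apply: leq_sum => i _.
    by rewrite /xl; case: (rd_short _); rewrite ?muln0 // mulnC.
  rewrite big_mkcond; apply: leq_sum => i _; case: ifP => // _.
  rewrite big_cons big_map chE -[X in iota 0 X]subn0 big_mkord.
  apply: leq_add; first by case: (chosen i 0); rewrite ?mul1n.
  by apply: leq_sum => l _; rewrite chE; case: (chosen _ _); rewrite ?mul1n.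
- move=> t; case: (posnP (minn (nth 0 d t) (load t))) => [->|gpos]; first by left.
  right; have gd : minn (nth 0 d t) (load t) < 2 ^ halvings (sumn d).
    apply: leq_ltn_trans (geq_minl _ _) (leq_ltn_trans _ (ltn_exp2_halvings _)).
    case: (ltnP t (size d)) => tT; last by rewrite nth_default.
    by rewrite sumnE (big_nth 0) big_mkord (bigD1 (Ordinal tT)) //= leq_addr.
  have [|i [h [ih hP it gh]]] := chosen_cov t _ _ gd.
    by rewrite gpos geq_minr.
  exists (mk (nat_of_ord i, h)); last by rewrite /holds /mk /= -/(r i) gh andbT.
  apply: map_f; rewrite mem_filter chE ih; apply/allpairsPdep; exists (nat_of_ord i), h.
  split=> //; rewrite mem_filter mem_iota ltn_ord andbT.
  by have := chosen_pos i h ih; rewrite /xl; case: (rd_short _).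
Qed.

(** The first bound makes the budget range polynomial; the second limits the rounding error to
    [pmax] per item. *)
Lemma sum_ceil_div_le (a pmax : nat) (l : seq nat) : (forall v, v \in l -> v <= pmax) ->
  \sum_(v <- l) ceil_div (a * v) pmax <= a * size l /\
  (\sum_(v <- l) ceil_div (a * v) pmax) * pmax <= a * sumn l + size l * pmax.
Proof.
elim: l => [|v l IH] Hl; first by rewrite big_nil /= muln0 mul0n.
have [|IH1 IH2] := IH; first by move=> v' v'l; apply: Hl; rewrite inE v'l orbT.
have vp : v <= pmax by apply: Hl; rewrite mem_head.
rewrite big_cons /= mulnDl mulnS mulnDr mulSn addnACA; split.
  by rewrite leq_add // ceil_div_le.
by rewrite leq_add // ceil_div_mul_le.
Qed.

Lemma final_entry_sound pmax e :
  e \in final_entries k T (dp_input d rs (boxes d rs p) (short_items rs p) pmax) ->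
  k <= e.1 /\ exists c, sound rs p (7 * N) pmax
    (dp_input d rs (boxes d rs p) (short_items rs p) pmax) ((0, T), (0, c)) e.
Proof.
rewrite mem_filter => /andP[ke /mapP[c _ eE]]; split=> //; exists c.
by rewrite eE dp_table_iter; apply: sound_dp_get.
Qed.

(** The items of the comparison solution, boxes and short resources, cost at most [14 * opt] and
    number fewer than [N]. Rounding at scale [7 * N] adds a seventh, and [14 * 8 / 7 = 16]. *)
Lemma exists_cheap_entry : exists2 e,
  e \in all_entries d rs (boxes d rs p) (short_items rs p) k &
  copies_cost p e.2 <= 16 * opt.
Proof.
have [B0 [B0sub B0size B0cost B0cov]] := exists_boxes.
pose L := [seq it_cost b | b <- B0] ++ [seq ps t | t <- iota 0 T].
(* The right guess is the largest item cost: no item is dropped, and [P] is at most the total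
   cost. *)
pose P := foldr maxn 0 L; pose A := 7 * N.
pose us t := ceil_div (A * ps t) P.
have LP v : v \in L -> v <= P by exact: foldr_maxn_ge.
have P_mem : P \in 0 :: [seq it_cost b | b <- boxes d rs p ++ short_items rs p].
  have := foldr_maxn_mem L; rewrite -/P inE => /orP[/eqP ->|]; first exact: mem_head.
  rewrite mem_cat => /orP[/mapP[b bB0 ->]|/mapP[t _ ->]].
    rewrite inE; apply/orP; right; apply/mapP; exists b => //.
    by rewrite mem_cat B0sub.
  rewrite /ps /short_at; case: pickP => [i /andP[/andP[si _] _]|_]; last exact: mem_head.
  rewrite inE; apply/orP; right; apply/mapP; exists (make_item rs p i 1).
    rewrite mem_cat; apply/orP; right; apply/mapP; exists (nat_of_ord i) => //.
    by rewrite mem_filter mem_iota ltn_ord /= andbT.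
  by rewrite /it_cost /= mul1n.
pose E := dp_input d rs (boxes d rs p) (short_items rs p) P.
have sizeL : size L <= size B0 + T by rewrite size_cat !size_map size_iota.
have N_gt : size B0 + T < N by rewrite /N size_item_bound ltnS leq_add2r.
have sumL : sumn L <= 14 * opt.
  rewrite sumn_cat !sumnE !big_map.
  have -> : \sum_(t <- iota 0 T) ps t = \sum_(0 <= t < T) ps t by rewrite /index_iota subn0.
  rewrite /opt (bigID (fun i : 'I_n => rd_short (r i))) /= mulnDr addnC leq_add //.
  by apply: leq_trans sum_ps_le _; rewrite leq_pmull.
have [U_le UP_le] := sum_ceil_div_le A LP.
set U := \sum_(v <- L) _ in U_le UP_le.
have UE : U = \sum_(b <- scaled A P B0) it_cost b + \sum_(0 <= t < T) us t.
  rewrite /U big_cat !big_map /index_iota subn0; congr addn.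
  rewrite big_filter [RHS]big_mkcond !big_seq; apply: eq_bigr => b bB0.
  by rewrite LP // mem_cat map_f.
have budE : dp_budgets E = iota 0 (8 * (N * N)).+1 by exact: budgetsE.
have AN : A * size L <= 7 * (N * N).
  by rewrite /A -mulnA leq_mul2l /= leq_mul2l (leq_trans sizeL (ltnW N_gt)) orbT.
have U_K : U < (8 * (N * N)).+1 by lia.
pose hs := 0 :: [seq it_height b | b <- boxes d rs p].
have keysP l r' h c : l <= size (dp_demands E) -> r' <= size (dp_demands E) ->
    h \in hs -> c < (8 * (N * N)).+1 -> ((l, r'), (h, c)) \in dp_keys E.
  move=> lT rT hh cK; apply: all_keysP => //.
  by rewrite budgetsE mem_iota.
have heightsP b : b \in dp_boxes E -> it_height b \in hs.
  case/mapP=> b0; rewrite mem_filter => /andP[_ b0P] ->.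
  by rewrite inE /it_height /= -/(it_height b0) map_f ?orbT.
have shortsP t : t < size (dp_demands E) -> ws t = 0 \/
    exists2 b, b \in dp_shorts E &
      [/\ it_start b = t, it_height b = ws t & it_cost b <= us t].
  move=> tT; have psL : ps t <= P.
    by apply: LP; rewrite mem_cat (map_f ps) ?orbT // mem_iota.
  rewrite /us; move: psL; rewrite /ws /ps /short_at.
  case: pickP => [i /andP[/andP[si /eqP st_i] _]|]; last by left.
  move=> piP; right; pose b := make_item rs p i 1.
  exists (it_res b, (it_mult b, (it_start b, (it_finish b,
         (it_height b, ceil_div (A * it_cost b) P))))).
    apply/mapP; exists b => //; rewrite mem_filter {1}/b /it_cost /= mul1n piP.
    apply/mapP; exists (nat_of_ord i) => //.
    by rewrite mem_filter mem_iota ltn_ord /= andbT.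
  by split; rewrite /b ?/it_height ?/it_cost /= ?mul1n.
have BE : {subset scaled A P B0 <= dp_boxes E}.
  move=> b /mapP[b0]; rewrite mem_filter => /andP[b0P b0B] ->; apply: map_f.
  by rewrite mem_filter b0P B0sub.
have sizeB : size (scaled A P B0) <= size B0 by rewrite size_map size_filter count_size.
have Bcov t : 0 <= t < T -> minn (nth 0 d t) (load t) <= 0 \/
    exists2 b, b \in scaled A P B0 &
      holds b t && (minn (nth 0 d t) (load t) <= it_height b).
  move=> _; case: (B0cov t) => [|[b bB0 Hb]]; [by left|right].
  exists (it_res b, (it_mult b, (it_start b, (it_finish b,
         (it_height b, ceil_div (A * it_cost b) P))))) => //.
  by apply/mapP; exists b => //; rewrite mem_filter bB0 andbT LP // mem_cat map_f.
pose e := dp_get E (dp_table E) ((0, T), (0, U)).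
have ke : k <= e.1.
  rewrite /e dp_table_iter budE size_iota.
  (* [B0] and the slots together number fewer than [N], so fewer than [3 * N] rounds are enough. *)
  have depth : 3 * size B0 + (T - 0) <= (8 * (N * N)).+1.
    have : N <= N * N by rewrite leq_pmull //; lia.
    lia.
  have cost_le : \sum_(b <- scaled A P B0) it_cost b + \sum_(0 <= t < T) us t <= U.
    by rewrite UE.
  apply: leq_trans (dp_complete keysP budE heightsP shortsP sizeB BE (leq0n T) (leqnn T)
    (mem_head 0 _) U_K depth Bcov cost_le).
  apply: leq_trans ko_target _; apply: leq_sum => t _; exact: ko_le.
have eF : e \in final_entries k T E.
  rewrite mem_filter ke andTb; apply/mapP; exists U => //.
  by rewrite budE mem_iota.
exists e; first (apply/flattenP; exists (final_entries k T E) => //;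
  by apply/mapP; exists P).
have [_ ecost _ _ _] : sound rs p A P E ((0, T), (0, U)) e.
  by rewrite /e dp_table_iter; apply: sound_dp_get.
move: ecost; rewrite /= => ecost.
have PV : P <= sumn L by exact: foldr_maxn_le_sumn.
have NP : size L * P <= N * sumn L by apply: leq_mul => //; apply: leq_trans (ltnW N_gt).
have N0 : 0 < N by [].
(* The rounding error [size L * P] is at most [N * sumn L], an eighth unit beside the seven in
   [A]. *)
have : N * (7 * copies_cost p e.2) <= N * (8 * sumn L).
  move: (leq_trans ecost UP_le); rewrite /A; lia.
rewrite leq_pmul2l //; lia.
Qed.

(** Every candidate is feasible by soundness, whatever guess it comes from; the cheapest is no
    dearer than the one from [exists_cheap_entry]. *)
Lemma choose_copies_spec : let x := choose_copies d rs k p in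
  [/\ size x = n, k <= \sum_(0 <= t < T) minn (nth 0 d t) (covered rs x t),
      forall t, shorts_at rs x t <= 1 & copies_cost p x <= 16 * opt].
Proof.
have [e eP ecost] := exists_cheap_entry.
have e2P : e.2 \in [seq e'.2 | e' <- all_entries d rs (boxes d rs p) (short_items rs p) k].
  exact: map_f.
have [/mapP[e' e'P xE] xcost] := cheapest_spec p [seq 0 | _ <- rs] e2P.
rewrite xE in xcost; rewrite [choose_copies _ _ _ _]xE.
case/flattenP: e'P => _ /mapP[pmax _ ->] /final_entry_sound[ke [c [se _ _ he ge]]].
split=> //; first by apply: leq_trans ke _.
exact: leq_trans xcost ecost.
Qed.

End Approximation.

(** * Encodings of instances and solutions *)

Lemma polytime_program A B `{encodable A} `{encodable B} (f : A -> B) :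
  polytime f -> exists (q : cmd) (b : {poly nat}), forall a, exists t,
    halts_with q (enc a) (enc (f a)) t /\ t <= (b.[esize a])%R.
Proof.
move=> [bf [T bT /(_ 0 1 isT)[q Hq]]].
have [k Hk] : pbound (fun a => (T a + (esize (f a)).+3).+1) by pb.
exists (Seq q (Assign 0 (Var 1))), (('X + 2%:P) ^+ k)%R => a.
have [s [t [qst tT [s0 _]]]] : runs (Seq q (Assign 0 (Var 1))) (init (enc a))
    ((T a + (esize (f a)).+3).+1) (fun s => s 0 = enc (f a) /\ True).
  apply: runs_seq (ltnSn _); apply: (runs_conseq (Hq (init (enc a)) a erefl)) => // s [s1 _].
  by apply: runs_assign => /=; rewrite s1 ?addn0.
exists t; split; first by exists s.
apply: (leq_trans tT); apply: (leq_trans (Hk a)).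
by rewrite horner_exp hornerD hornerX hornerC natrXE -[(_ + 2)%R]/(esize a + 2) addn2.
Qed.

Section Encoding.
Variable I : lspc_instance.

Definition resource_entry T (r : resource T) : resource_data :=
  (is_short r, (nat_of_ord (start r), (nat_of_ord (finish r), (capacity r,
    ((`|numq (price r)|, `|denq (price r)|), tt))))).

Definition demands : seq nat := [seq demand I t | t : 'I_(horizon I)].
Definition resources : seq resource_data :=
  [seq resource_entry (res I i) | i : 'I_(num_resources I)].
Definition instance_data : lspc_data := (demands, (resources, (target I, tt))).

Lemma enc_instance_data : enc instance_data = enc_lspc_instance I.
Proof.
rewrite /enc_lspc_instance /= /demands /resources /image_mem -!map_comp.
by [].
Qed.

Lemma size_demands : size demands = horizon I.
Proof. by rewrite size_map size_enum_ord. Qed.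

Lemma size_resources : size resources = num_resources I.
Proof. by rewrite size_map size_enum_ord. Qed.

Lemma nth_demands (t : 'I_(horizon I)) : nth 0 demands t = demand I t.
Proof. by rewrite (nth_map t) ?size_enum_ord // nth_ord_enum. Qed.

Lemma nth_resources (i : 'I_(num_resources I)) :
  nth rd0 resources i = resource_entry (res I i).
Proof. by rewrite (nth_map i) ?size_enum_ord // nth_ord_enum. Qed.

Definition to_solution (x y : seq nat) : lspc_solution I :=
  LSPCSolution (fun i => nth 0 x i) (fun t => nth 0 y t).

Lemma map_nth_ord n (x : seq nat) : size x = n ->
  [seq Leaf (nth 0 x i) | i : 'I_n] = map Leaf x.
Proof.
move=> <-; rewrite /image_mem -[in RHS](mkseq_nth 0 x) /mkseq -val_enum_ord -!map_comp.
by [].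
Qed.

Lemma enc_to_solution x y : size x = num_resources I -> size y = horizon I ->
  enc (x, (y, tt)) = enc_lspc_solution (to_solution x y).
Proof. by move=> sx sy; rewrite /enc_lspc_solution !map_nth_ord. Qed.

Lemma rd_active_res (i : 'I_(num_resources I)) (t : 'I_(horizon I)) :
  rd_active resources i t = active (res I i) t.
Proof. by rewrite /rd_active nth_resources. Qed.

Lemma short_single_data i : i < size resources -> rd_short (nth rd0 resources i) ->
  rd_finish (nth rd0 resources i) = rd_start (nth rd0 resources i).
Proof.
rewrite size_resources => iN; rewrite (nth_resources (Ordinal iN)).
by rewrite /rd_finish /rd_start /= => /(@short_single _ _) ->.
Qed.

Definition price_denominator : nat := foldl muln 1 [seq rd_den r | r <- resources].

Lemma foldl_mulnE z l : foldl muln z l = z * \prod_(a <- l) a.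
Proof.
by elim: l z => [|a l IH] z /=; rewrite ?big_nil ?muln1 // IH big_cons mulnA.
Qed.

Lemma rd_den_gt0 r : r \in resources -> 0 < rd_den r.
Proof. by case/mapP => i _ ->; rewrite /rd_den /= absz_gt0 denq_neq0. Qed.

Lemma price_denominator_gt0 : 0 < price_denominator.
Proof.
rewrite /price_denominator foldl_mulnE mul1n big_map big_seq.
by apply: prodn_cond_gt0 => r; exact: rd_den_gt0.
Qed.

Lemma int_pricesE (i : 'I_(num_resources I)) :
  ((nth 0 (int_prices resources) i)%:R = price (res I i) * price_denominator%:R :> rat)%R.
Proof.
have iN : i < size resources by rewrite size_resources.
rewrite (nth_map rd0) // nth_resources /rd_num /rd_den /=.
set q := price _; have q0 : (0 <= q)%R := price_ge0 _.
(* Each denominator is a factor of the product, so the integer division in [int_prices] is exact. *)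
have den_dvd : `|denq q| %| price_denominator.
  rewrite /price_denominator foldl_mulnE mul1n big_map.
  have := mem_nth rd0 iN; rewrite nth_resources => /(big_rem _) -> /=.
  by rewrite dvdn_mulr.
rewrite -/price_denominator -{2}(divnK den_dvd) !natrM.
have -> : (`|numq q|%:R = (numq q)%:~R :> rat)%R.
  by rewrite -[RHS]/((numq q)%:~R)%R -{2}[numq q]gez0_abs ?numq_ge0.
have -> : (`|denq q|%:R = (denq q)%:~R :> rat)%R.
  by rewrite -{2}[denq q]gez0_abs ?denq_ge0.
by rewrite numqE -mulrA [in LHS](mulrC (denq q)%:~R)%R.
Qed.

Let prices := int_prices resources.
Let x := choose_copies demands resources (target I) prices.
Let y := coverage_list demands resources x.

Lemma nth_coverage_list (t : 'I_(horizon I)) :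
  nth 0 y t = minn (demand I t) (covered resources x t).
Proof.
by rewrite (nth_map 0) ?size_iota ?size_demands // nth_iota ?size_demands // nth_demands.
Qed.

Lemma covered_res z (t : 'I_(horizon I)) : covered resources z t =
  \sum_(i | active (res I i) t) nth 0 z i * capacity (res I i).
Proof.
rewrite coveredE size_resources; apply: eq_big => i; first exact: rd_active_res.
by rewrite nth_resources.
Qed.

Lemma copies_cost_res z : size z = num_resources I ->
  ((copies_cost prices z)%:R =
   (\sum_i price (res I i) *+ nth 0 z i) * price_denominator%:R :> rat)%R.
Proof.
move=> sz; rewrite copies_costE sz natr_sum mulr_suml; apply: eq_bigr => i _.
by rewrite natrM int_pricesE -[(price _ *+ _)%R]mulr_natl mulrA.
Qed.

Section Optimality.
Variable S : lspc_solution I.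
Hypothesis S_feasible : lspc_feasible S.

(** Extension by 0 to all numbers, because the analysis indexes by the lengths of the data lists
    instead of the ordinals of the instance. *)
Let c (i : nat) := if insub i is Some i' then copies S i' else 0.
Let v (t : nat) := if insub t is Some t' then coverage S t' else 0.

Lemma choose_copies_res : [/\ size x = num_resources I,
    target I <= \sum_(t < horizon I) minn (demand I t) (covered resources x t),
    forall t, shorts_at resources x t <= 1
  & copies_cost prices x <=
      16 * \sum_(i < num_resources I) copies S i * nth 0 prices i].
Proof.
have [v_demand v_target v_covered c_short] := S_feasible.
have cE (i : 'I_(num_resources I)) : c i = copies S i by rewrite /c valK.
have vE (t : 'I_(horizon I)) : v t = coverage S t by rewrite /v valK.
have := @choose_copies_spec demands resources prices (target I) short_single_data
  (fun i => c i) v.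
rewrite size_demands size_resources -/x; case.
- move=> t; rewrite /v; case: insubP => [t' _ <-|//].
  by rewrite nth_demands.
- apply: leq_trans v_target _; rewrite big_mkord; apply: eq_leq.
  by apply: eq_bigr => t _; rewrite vE.
- move=> t; rewrite /v; case: insubP => [t' _ <-|//].
  apply: leq_trans (v_covered t') _; apply: eq_leq.
  apply: eq_big => i; first by rewrite rd_active_res.
  by rewrite nth_resources cE.
- move=> t; case: (ltnP t (horizon I)) => tT; last first.
    rewrite big1 // => i /andP[_ /eqP si]; move: tT; rewrite -si nth_resources.
    by rewrite /rd_start /= leqNgt ltn_ord.
  apply: leq_trans (c_short (Ordinal tT)); apply: eq_leq.
  apply: eq_big => i; last by rewrite cE.
  rewrite nth_resources /rd_short /rd_start /=; case: (boolP (is_short _)) => //= si.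
  by rewrite /active -(short_single si) /= -eqn_leq.
move=> sx kx shx costx; split=> //.
- by move: kx; rewrite big_mkord; under eq_bigr => t _ do rewrite nth_demands.
- apply: leq_trans costx _; rewrite leq_mul2l /=; apply: eq_leq.
  by apply: eq_bigr => i _; rewrite cE.
Qed.

Lemma to_solution_feasible : lspc_feasible (to_solution x y).
Proof.
have [sx kx shx _] := choose_copies_res; split=> /=.
- by move=> t; rewrite nth_coverage_list geq_minl.
- apply: leq_trans kx _; apply: eq_leq; apply: eq_bigr => t _.
  by rewrite nth_coverage_list.
- by move=> t; rewrite nth_coverage_list -covered_res geq_minr.
- move=> t; apply: leq_trans (shx t); rewrite /shorts_at size_resources.
  apply: eq_leq; apply: eq_bigl => i; rewrite nth_resources.
  rewrite /rd_short /rd_start /=; case: (boolP (is_short _)) => //= si.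
  by rewrite /active -(short_single si) /= -eqn_leq.
Qed.

Lemma to_solution_cost : (lspc_cost (to_solution x y) <= 16 * lspc_cost S)%R.
Proof.
have [sx _ _] := choose_copies_res; rewrite -(ler_nat rat).
rewrite copies_cost_res // natrM natr_sum.
have D0 : (0 < price_denominator%:R :> rat)%R by rewrite ltr0n price_denominator_gt0.
have -> : (\sum_(i < num_resources I) (copies S i * nth 0 prices i)%:R =
    lspc_cost S * price_denominator%:R :> rat)%R.
  rewrite mulr_suml; apply: eq_bigr => i _.
  by rewrite natrM int_pricesE -[(price _ *+ _)%R]mulr_natl mulrA.
by rewrite mulrA ler_pM2r.
Qed.

End Optimality.
End Encoding.

Theorem theorem4 : exists p : cmd, approximation_algorithm LSPC 16%R p.
Proof.
have [q [b Hq]] := polytime_program polytime_lspc_algorithm.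
exists q, b => I; have [t [qt tb]] := Hq (instance_data I).
exists (enc (lspc_algorithm (instance_data I))), t.
rewrite /esize enc_instance_data in qt tb; split=> //.
(* The output does not depend on [S0], which only witnesses feasibility; the cost bound is then
   applied to each [S'] separately. *)
case=> S0 S0f; set x := choose_copies (demands I) (resources I) (target I)
  (int_prices (resources I)).
exists (to_solution I x (coverage_list (demands I) (resources I) x)); split.
- apply: enc_to_solution; first by have [] := choose_copies_res S0f.
  by rewrite size_map size_iota size_demands.
- exact: to_solution_feasible S0f.
- by move=> S' S'f; apply: to_solution_cost.
Qed.
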